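(* The following are equivalent over $\mathsf{RCA}_0$. (i) $\mathsf{ACA}_0$. (ii) For every quasi-order $Q$, if $Q$ is a wqo, then $\mathcal{P}_{\mathrm f}^\flat(Q)$ is a wqo.
   Context: $\mathsf{RCA}_0$ is the usual base theory of second-order arithmetic: the axioms of a discretely ordered commutative semiring with identity for $\mathbb{N}$, $\Sigma^0_1$ induction, and $\Delta^0_1$ comprehension. $\mathsf{ACA}_0$ is $\mathsf{RCA}_0$ plus arithmetical comprehension. All sets are subsets of $\mathbb{N}$, with the usual coding of pairs and finite sets as numbers. A quasi-order is a set $Q$ with a reflexive transitive relation $\leq_Q$. It is a well-quasi-order (wqo) if for every $f\colon\mathbb{N}\to Q$ there are $m<n$ with $f(m)\leq_Q f(n)$. $\mathcal{P}_{\mathrm f}^\flat(Q)$ is the quasi-order whose domain is the set $\mathcal{P}_{\mathrm f}(Q)$ of (codes of) finite subsets of $Q$, with $\mathbf a\leq_Q^\flat\mathbf b$ iff $(\forall a\in\mathbf a)(\exists b\in\mathbf b)(a\leq_Q b)$. *)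

(* Defs.v *)
From Stdlib Require Import List.
Import ListNotations.

Set Implicit Arguments.

(** * The language of second-order arithmetic

    Variables are de Bruijn indices.  Number variables and set variables live
    in two separate index spaces: a number quantifier leaves the set indices
    unchanged and vice versa.  Set variables are the only set terms. *)

Inductive term : Type :=
| var (n : nat)
| zero
| one
| plus (t u : term)
| mult (t u : term).

Inductive form : Type :=
| bot
| eqn (t u : term)
| ltn (t u : term)
| mem (t : term) (X : nat)
| imp (phi psi : form)
| all1 (phi : form)   (* over numbers *)
| all2 (phi : form).  (* over sets *)

Fixpoint tsubst (s : nat -> term) (t : term) : term :=
  match t with
  | var n => s n
  | zero => zero
  | one => one
  | plus t u => plus (tsubst s t) (tsubst s u)
  | mult t u => mult (tsubst s t) (tsubst s u)
  end.

Definition lift (k : nat) (t : term) : term := tsubst (fun n => var (k + n)) t.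

Definition up1 (s : nat -> term) (n : nat) : term :=
  match n with 0 => var 0 | S n => lift 1 (s n) end.

Definition up2 (r : nat -> nat) (n : nat) : nat :=
  match n with 0 => 0 | S n => S (r n) end.

(** Simultaneous substitution of the terms [s] for the number variables and
    renaming of the set variables by [r]. *)
Fixpoint subst (s : nat -> term) (r : nat -> nat) (phi : form) : form :=
  match phi with
  | bot => bot
  | eqn t u => eqn (tsubst s t) (tsubst s u)
  | ltn t u => ltn (tsubst s t) (tsubst s u)
  | mem t X => mem (tsubst s t) (r X)
  | imp phi psi => imp (subst s r phi) (subst s r psi)
  | all1 phi => all1 (subst (up1 s) r phi)
  | all2 phi => all2 (subst s (up2 r) phi)
  end.

Definition shift1 : form -> form := subst (fun n => var (S n)) (fun X => X).
Definition shift2 : form -> form := subst var S.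

Definition inst1 (t : term) : form -> form :=
  subst (fun n => match n with 0 => t | S n => var n end) (fun X => X).
Definition inst2 (Y : nat) : form -> form :=
  subst var (fun X => match X with 0 => Y | S X => X end).

Definition Neg (phi : form) : form := imp phi bot.
Definition And (phi psi : form) : form := Neg (imp phi (Neg psi)).
Definition Or (phi psi : form) : form := imp (Neg phi) psi.
Definition Iff (phi psi : form) : form := And (imp phi psi) (imp psi phi).
Definition ex1 (phi : form) : form := Neg (all1 (Neg phi)).
Definition ex2 (phi : form) : form := Neg (all2 (Neg phi)).

Declare Scope L2_scope.
Delimit Scope L2_scope with L2.
Bind Scope L2_scope with term form.
Open Scope L2_scope.

Notation "# n" := (var n) (at level 1, n at level 1, format "# n") : L2_scope.
Infix "⊕" := plus (at level 50, left associativity) : L2_scope.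
Infix "⊗" := mult (at level 40, left associativity) : L2_scope.
Infix "≐" := eqn (at level 70, no associativity) : L2_scope.
Infix "≺" := ltn (at level 70, no associativity) : L2_scope.
Infix "∈" := mem (at level 70, no associativity) : L2_scope.
Notation "¬ phi" := (Neg phi) (at level 75, right associativity) : L2_scope.
Infix "⋏" := And (at level 80, right associativity) : L2_scope.
Infix "⋎" := Or (at level 85, right associativity) : L2_scope.
Infix "⟶" := imp (at level 90, right associativity) : L2_scope.
Infix "⟷" := Iff (at level 95, no associativity) : L2_scope.
Notation "∀¹ phi" := (all1 phi) (at level 75, right associativity) : L2_scope.
Notation "∃¹ phi" := (ex1 phi) (at level 75, right associativity) : L2_scope.
Notation "∀² phi" := (all2 phi) (at level 75, right associativity) : L2_scope.
Notation "∃² phi" := (ex2 phi) (at level 75, right associativity) : L2_scope.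

(** * Provability

    Classical two-sorted natural deduction with equality on numbers.  The free
    variables of the axioms in [T] are implicitly universally quantified, so
    in the generalization rules only the hypotheses in [G] are shifted. *)

Inductive prv (T : form -> Prop) : list form -> form -> Prop :=
| prv_ax G phi : T phi -> prv T G phi
| prv_hyp G phi : In phi G -> prv T G phi
| prv_impI G phi psi : prv T (phi :: G) psi -> prv T G (phi ⟶ psi)
| prv_impE G phi psi : prv T G (phi ⟶ psi) -> prv T G phi -> prv T G psi
| prv_raa G phi : prv T ((¬ phi) :: G) bot -> prv T G phi
| prv_all1I G phi : prv T (map shift1 G) phi -> prv T G (∀¹ phi)
| prv_all1E G phi t : prv T G (∀¹ phi) -> prv T G (inst1 t phi)
| prv_all2I G phi : prv T (map shift2 G) phi -> prv T G (∀² phi)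
| prv_all2E G phi Y : prv T G (∀² phi) -> prv T G (inst2 Y phi)
| prv_refl G t : prv T G (t ≐ t)
| prv_leibniz G phi t u :
    prv T G (t ≐ u) -> prv T G (inst1 t phi) -> prv T G (inst1 u phi).

Definition proves (T : form -> Prop) (phi : form) : Prop := prv T [] phi.

(** The theories [A] and [B] (sets of axioms, possibly infinite) are equivalent
    over the base theory [T]. *)
Definition equivalent_over (T A B : form -> Prop) : Prop :=
  (forall phi, B phi -> proves (fun psi => T psi \/ A psi) phi) /\
  (forall phi, A phi -> proves (fun psi => T psi \/ B psi) phi).

(** * The systems RCA0 and ACA0 *)

Definition leq (t u : term) : form := t ≺ u ⋎ t ≐ u.

(** Kaye's axioms PA^- for the nonnegative part of a discretely ordered
    commutative ring with identity. *)
Inductive semiring_axiom : form -> Prop :=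
| ax_addA : semiring_axiom ((#0 ⊕ #1) ⊕ #2 ≐ #0 ⊕ (#1 ⊕ #2))
| ax_addC : semiring_axiom (#0 ⊕ #1 ≐ #1 ⊕ #0)
| ax_mulA : semiring_axiom ((#0 ⊗ #1) ⊗ #2 ≐ #0 ⊗ (#1 ⊗ #2))
| ax_mulC : semiring_axiom (#0 ⊗ #1 ≐ #1 ⊗ #0)
| ax_mulDr : semiring_axiom (#0 ⊗ (#1 ⊕ #2) ≐ #0 ⊗ #1 ⊕ #0 ⊗ #2)
| ax_add0 : semiring_axiom (#0 ⊕ zero ≐ #0)
| ax_mul0 : semiring_axiom (#0 ⊗ zero ≐ zero)
| ax_mul1 : semiring_axiom (#0 ⊗ one ≐ #0)
| ax_lt_trans : semiring_axiom (#0 ≺ #1 ⋏ #1 ≺ #2 ⟶ #0 ≺ #2)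
| ax_lt_irrefl : semiring_axiom (¬ #0 ≺ #0)
| ax_lt_total : semiring_axiom (#0 ≺ #1 ⋎ #0 ≐ #1 ⋎ #1 ≺ #0)
| ax_lt_add : semiring_axiom (#0 ≺ #1 ⟶ #0 ⊕ #2 ≺ #1 ⊕ #2)
| ax_lt_mul : semiring_axiom (zero ≺ #2 ⋏ #0 ≺ #1 ⟶ #0 ⊗ #2 ≺ #1 ⊗ #2)
| ax_sub : semiring_axiom (#0 ≺ #1 ⟶ ∃¹ (#1 ⊕ #0 ≐ #2))
| ax_lt01 : semiring_axiom (zero ≺ one)
| ax_discrete : semiring_axiom (zero ≺ #0 ⟶ leq one #0)
| ax_le0 : semiring_axiom (leq zero #0).

(** Formulas all of whose quantifiers are bounded number quantifiers.  As
    [lift 1 t] does not contain the quantified variable, neither does the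
    bound. *)
Inductive Sigma00 : form -> Prop :=
| Sigma00_bot : Sigma00 bot
| Sigma00_eqn t u : Sigma00 (t ≐ u)
| Sigma00_ltn t u : Sigma00 (t ≺ u)
| Sigma00_mem t X : Sigma00 (t ∈ X)
| Sigma00_imp phi psi : Sigma00 phi -> Sigma00 psi -> Sigma00 (phi ⟶ psi)
| Sigma00_ball t phi : Sigma00 phi -> Sigma00 (∀¹ (#0 ≺ lift 1 t ⟶ phi))
| Sigma00_bex t phi : Sigma00 phi -> Sigma00 (∃¹ (#0 ≺ lift 1 t ⋏ phi)).

Definition Sigma01 (phi : form) : Prop :=
  exists theta, Sigma00 theta /\ phi = ∃¹ theta.

Definition Pi01 (phi : form) : Prop :=
  exists theta, Sigma00 theta /\ phi = ∀¹ theta.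

Fixpoint arithmetical (phi : form) : Prop :=
  match phi with
  | bot | eqn _ _ | ltn _ _ | mem _ _ => True
  | imp phi psi => arithmetical phi /\ arithmetical psi
  | all1 phi => arithmetical phi
  | all2 _ => False
  end.

(** [phi] as a property of its number variable 0; all other free variables are
    parameters. *)
Definition induction_for (phi : form) : form :=
  inst1 zero phi ⋏
  ∀¹ (phi ⟶ subst (fun n => match n with 0 => #0 ⊕ one | S n => #(S n) end)
                  (fun X => X) phi)
  ⟶ ∀¹ phi.

(** [shift2] ensures that the new set variable is not free in [phi]. *)
Definition comprehension_for (phi : form) : form :=
  ∃² ∀¹ (#0 ∈ 0 ⟷ shift2 phi).

Inductive RCA0 : form -> Prop :=
| RCA0_semiring phi : semiring_axiom phi -> RCA0 phi
| RCA0_induction phi : Sigma01 phi -> RCA0 (induction_for phi)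
| RCA0_comprehension phi psi : Sigma01 phi -> Pi01 psi ->
    RCA0 (∀¹ (phi ⟷ psi) ⟶ comprehension_for phi).

Inductive ACA0 : form -> Prop :=
| ACA0_RCA0 phi : RCA0 phi -> ACA0 phi
| ACA0_comprehension phi : arithmetical phi -> ACA0 (comprehension_for phi).

(** * Codes of pairs and of finite sets *)

Definition pair_code (t u : term) : term := (t ⊕ u) ⊗ (t ⊕ u) ⊕ t.

Definition triple_code (t u v : term) : term := pair_code t (pair_code u v).

Definition is_triple (c : term) : form :=
  ∃¹ ∃¹ ∃¹ (lift 3 c ≐ triple_code #2 #1 #0).

(** The triple [(k, m, n)] represents the finite set of all [x < k] such that
    [m (x + 1) + 1] divides [n]. *)
Definition fin_mem (x c : term) : form :=
  ∃¹ ∃¹ ∃¹ (lift 3 c ≐ triple_code #2 #1 #0 ⋏ lift 3 x ≺ #2 ⋏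
            ∃¹ (#1 ≐ (#2 ⊗ (lift 4 x ⊕ one) ⊕ one) ⊗ #0)).

(** The code of a finite set is the least triple that represents it. *)
Definition fin_code (c : term) : form :=
  is_triple c ⋏
  ∀¹ (#0 ≺ lift 1 c ⋏ is_triple #0 ⟶
      ¬ ∀¹ (fin_mem #0 (lift 2 c) ⟷ fin_mem #0 #1)).

(** * Well-quasi-orders

    The arguments [Q R F P S] below are indices of set variables. *)

(** [R] is a reflexive and transitive relation on [Q]. *)
Definition quasi_order (Q R : nat) : form :=
  ∀¹ (#0 ∈ R ⟶ ∃¹ ∃¹ (#1 ∈ Q ⋏ #0 ∈ Q ⋏ #2 ≐ pair_code #1 #0)) ⋏
  ∀¹ (#0 ∈ Q ⟶ pair_code #0 #0 ∈ R) ⋏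
  ∀¹ ∀¹ ∀¹ (pair_code #2 #1 ∈ R ⋏ pair_code #1 #0 ∈ R ⟶ pair_code #2 #0 ∈ R).

(** [F] is (the graph of) a function from the numbers to [Q]. *)
Definition sequence_in (F Q : nat) : form :=
  ∀¹ (#0 ∈ F ⟶ ∃¹ ∃¹ (#0 ∈ Q ⋏ #2 ≐ pair_code #1 #0)) ⋏
  ∀¹ ∃¹ (pair_code #1 #0 ∈ F) ⋏
  ∀¹ ∀¹ ∀¹ (pair_code #2 #1 ∈ F ⋏ pair_code #2 #0 ∈ F ⟶ #1 ≐ #0).

Definition wqo (Q R : nat) : form :=
  quasi_order Q R ⋏
  ∀² (sequence_in 0 (S Q) ⟶
      ∃¹ ∃¹ ∃¹ ∃¹ (#3 ≺ #2 ⋏ pair_code #3 #1 ∈ 0 ⋏ pair_code #2 #0 ∈ 0 ⋏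
                   pair_code #1 #0 ∈ S R)).

(** [P] is the set of codes of finite subsets of [Q], and [S] is the relation
    on [P] that holds of [a] and [b] when every element of [a] is below some
    element of [b] with respect to [R]. *)
Definition is_Pf_flat (Q R P S : nat) : form :=
  ∀¹ (#0 ∈ P ⟷ fin_code #0 ⋏ ∀¹ (fin_mem #0 #1 ⟶ #0 ∈ Q)) ⋏
  ∀¹ (#0 ∈ S ⟷
      ∃¹ ∃¹ (#2 ≐ pair_code #1 #0 ⋏ #1 ∈ P ⋏ #0 ∈ P ⋏
             ∀¹ (fin_mem #0 #2 ⟶ ∃¹ (fin_mem #0 #2 ⋏ pair_code #1 #0 ∈ R)))).

(** For every quasi-order [(Q, R)], if it is a wqo, then the set [P] of finite
    subsets of [Q] with its relation [S] exists and is a wqo. *)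
Definition Pf_flat_preserves_wqo : form :=
  ∀² ∀² (quasi_order 1 0 ⟶ wqo 1 0 ⟶
         ∃² ∃² (is_Pf_flat 3 2 1 0 ⋏ wqo 1 0)).

(* Main.v *)
From Stdlib Require Import List Arith Lia Cantor Classical ClassicalEpsilon
  FunctionalExtensionality PropExtensionality ProofIrrelevance.
Require Import Defs.
Import ListNotations.

(** Both implications are proved semantically. By the completeness theorem
    [completeness] it is enough to show, for every model of [RCA0], that it is
    closed under arithmetical comprehension if and only if it satisfies the
    statement about finite powersets; within one model the argument is ordinary
    mathematics, except that induction, minimization and comprehension apply
    only to predicates that are definable at the right level. Those predicates
    form the classes [Def0] (bounded formulas), [Def1] ([Sigma^0_1]) and [Rec]
    ([Delta^0_1]), whose closure properties replace the writing of formulas.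

    The coding of finite sets rests on one case of Euclid's lemma
    ([modulus_coprime]): with it every recursive set has a code below any bound
    ([exact_code], [finite_set]). From codes come primitive recursion
    ([recursion]) and the fact that a recursive function with bounded values has
    taken all of them by some stage ([values_exhausted]).

    From arithmetical comprehension to powersets. Let [a] be a bad sequence of
    finite subsets of [Q]. Call a finite set [c] good if for infinitely many [n]
    no element of [c] is below an element of [a n]. The empty set is good, and a
    good set [c] can be extended ([Good_step]): choose [n] such that [a n] lies
    above no element of [c]; each later [a m] with this property has, as [a n]
    is not below [a m], nothing above some element of [a n], and by the
    pigeonhole principle one element [x] of [a n] serves for infinitely many
    [m]. As [x] lies above no element of [c], iteration yields a bad sequence in
    [Q] ([bad_elements], [Pf_flat_WellQuasiOrder]).

    From powersets to arithmetical comprehension. It is enough to obtain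
    [Sigma^0_1] comprehension; the quantifiers of an arithmetical formula are
    then removed one at a time ([arithmetical_comprehension]). A [Sigma^0_1] set
    is enumerated by an injection [h], and it is recursive in any unbounded
    sequence of true stages, that is of numbers [p] such that [h] never falls
    below [h p] after [p]. Order the pairs [(p, c)] by letting [(p, c)] be below
    [(p', c')] if [p = p'] and [c <= c'], or if [p'] is so large that [p] has
    been seen to be false. A bad sequence in this order has true and unbounded
    first components, by [values_exhausted]. On the other hand the finite sets
    of all pairs [(p, c)] with [p] still true at stage [s] and [c] the least
    value of [h] between [p] and [s] form a bad sequence of finite sets
    ([stage_sets_bad]): the value that follows the last true stage decreases.
    Hence the order is not a well-quasi-order, and true stages are available
    ([true_stages], [Sigma1_comprehension]). *)

Set Implicit Arguments.

(** * Substitution *)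

Lemma tsubst_comp s s' t :
  tsubst s' (tsubst s t) = tsubst (fun n => tsubst s' (s n)) t.
Proof. induction t; simpl; congruence. Qed.

Lemma tsubst_id t : tsubst var t = t.
Proof. induction t; simpl; congruence. Qed.

Lemma up1_id : up1 var = var.
Proof. apply functional_extensionality; intros [|n]; reflexivity. Qed.

Lemma up2_id : up2 (fun X => X) = (fun X => X).
Proof. apply functional_extensionality; intros [|n]; reflexivity. Qed.

Lemma subst_id phi : subst var (fun X => X) phi = phi.
Proof.
  induction phi; simpl; rewrite ?tsubst_id, ?up1_id, ?up2_id; congruence.
Qed.

Lemma up1_comp s s' :
  (fun n => tsubst (up1 s') (up1 s n)) = up1 (fun n => tsubst s' (s n)).
Proof.
  apply functional_extensionality; intros [|n]; simpl; trivial.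
  unfold lift. rewrite !tsubst_comp. reflexivity.
Qed.

Lemma up2_comp r r' :
  (fun X => up2 r' (up2 r X)) = up2 (fun X => r' (r X)).
Proof. apply functional_extensionality; intros [|n]; reflexivity. Qed.

Lemma subst_comp phi : forall s r s' r',
  subst s' r' (subst s r phi) =
  subst (fun n => tsubst s' (s n)) (fun X => r' (r X)) phi.
Proof.
  induction phi; intros; simpl;
    rewrite ?tsubst_comp, ?IHphi, ?IHphi1, ?IHphi2, ?up1_comp, ?up2_comp;
    reflexivity.
Qed.

Definition scons {A : Type} (a : A) (e : nat -> A) (n : nat) : A :=
  match n with 0 => a | S n => e n end.

Lemma inst1_subst t phi : inst1 t phi = subst (scons t var) (fun X => X) phi.
Proof. reflexivity. Qed.

Lemma inst2_subst Y phi : inst2 Y phi = subst var (scons Y (fun X => X)) phi.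
Proof. reflexivity. Qed.

Lemma inst1_up1 t s r phi :
  inst1 t (subst (up1 s) r phi) = subst (scons t s) r phi.
Proof.
  rewrite inst1_subst, subst_comp. f_equal.
  apply functional_extensionality. intros [|n]; simpl; trivial.
  unfold lift. rewrite tsubst_comp. apply tsubst_id.
Qed.

Lemma inst2_up2 Y s r phi :
  inst2 Y (subst s (up2 r) phi) = subst s (scons Y r) phi.
Proof.
  rewrite inst2_subst, subst_comp. f_equal.
  - apply functional_extensionality. intros n. apply tsubst_id.
  - apply functional_extensionality. intros [|n]; reflexivity.
Qed.

Lemma subst_inst1 t s r phi :
  subst s r (inst1 t phi) = inst1 (tsubst s t) (subst (up1 s) r phi).
Proof.
  rewrite inst1_up1, inst1_subst, subst_comp. f_equal.
  apply functional_extensionality. intros [|n]; reflexivity.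
Qed.

Lemma subst_inst2 Y s r phi :
  subst s r (inst2 Y phi) = inst2 (r Y) (subst s (up2 r) phi).
Proof.
  rewrite inst2_up2, inst2_subst, subst_comp. f_equal.
  apply functional_extensionality. intros [|n]; reflexivity.
Qed.

Lemma subst_shift1 s r phi :
  subst (up1 s) r (shift1 phi) = shift1 (subst s r phi).
Proof.
  unfold shift1. rewrite !subst_comp. reflexivity.
Qed.

Lemma subst_shift2 s r phi :
  subst s (up2 r) (shift2 phi) = shift2 (subst s r phi).
Proof.
  unfold shift2. rewrite !subst_comp. f_equal.
  apply functional_extensionality; intro n. symmetry. apply tsubst_id.
Qed.

(** Bounds on the free variables supply fresh variables, and make the universal
    closure of a formula finite. *)
Fixpoint tbounded (n : nat) (t : term) : Prop :=
  match t with
  | var i => i < n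
  | zero | one => True
  | plus t u | mult t u => tbounded n t /\ tbounded n u
  end.

Fixpoint bounded (n m : nat) (phi : form) : Prop :=
  match phi with
  | bot => True
  | eqn t u | ltn t u => tbounded n t /\ tbounded n u
  | mem t X => tbounded n t /\ X < m
  | imp phi psi => bounded n m phi /\ bounded n m psi
  | all1 phi => bounded (S n) m phi
  | all2 phi => bounded n (S m) phi
  end.

Lemma tbounded_mono t n n' : n <= n' -> tbounded n t -> tbounded n' t.
Proof. induction t; simpl; intuition lia. Qed.

Lemma bounded_mono phi : forall n n' m m',
  n <= n' -> m <= m' -> bounded n m phi -> bounded n' m' phi.
Proof.
  induction phi; simpl; intros n' n'' m m' Hn Hm H; auto.
  - destruct H; split; eapply tbounded_mono; eauto.
  - destruct H; split; eapply tbounded_mono; eauto.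
  - destruct H; split; [eapply tbounded_mono; eauto | lia].
  - destruct H; split; eauto.
  - eapply IHphi; [| |exact H]; lia.
  - eapply IHphi; [| |exact H]; lia.
Qed.

Lemma tbounded_exists t : exists n, tbounded n t.
Proof.
  induction t as [n| | |t [n Hn] u [m Hm]|t [n Hn] u [m Hm]].
  - exists (S n); simpl; lia.
  - exists 0; exact I.
  - exists 0; exact I.
  - exists (n + m); split; (eapply tbounded_mono; [|eassumption]; lia).
  - exists (n + m); split; (eapply tbounded_mono; [|eassumption]; lia).
Qed.

Lemma bounded_exists phi : exists n, bounded n n phi.
Proof.
  induction phi as [|t u|t u|t X|phi [n Hn] psi [m Hm]|phi [n Hn]|phi [n Hn]].
  - exists 0; exact I.
  - destruct (tbounded_exists t) as [n Hn], (tbounded_exists u) as [m Hm].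
    exists (n + m); split; (eapply tbounded_mono; [|eassumption]; lia).
  - destruct (tbounded_exists t) as [n Hn], (tbounded_exists u) as [m Hm].
    exists (n + m); split; (eapply tbounded_mono; [|eassumption]; lia).
  - destruct (tbounded_exists t) as [n Hn].
    exists (S (n + X)); split; [eapply tbounded_mono; [|eassumption]; lia|lia].
  - exists (n + m); split; (eapply bounded_mono; [| |eassumption]; lia).
  - exists n. eapply (bounded_mono phi (n' := S n)); [| |exact Hn]; lia.
  - exists n. eapply (bounded_mono phi (m' := S n)); [| |exact Hn]; lia.
Qed.

Lemma tsubst_ext n t s s' :
  tbounded n t -> (forall i, i < n -> s i = s' i) -> tsubst s t = tsubst s' t.
Proof.
  induction t; simpl; intros H E; trivial; auto; f_equal; intuition.
Qed.

Lemma subst_ext phi : forall n m s s' r r',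
  bounded n m phi ->
  (forall i, i < n -> s i = s' i) -> (forall i, i < m -> r i = r' i) ->
  subst s r phi = subst s' r' phi.
Proof.
  induction phi; simpl; intros n' m s s' r r' B Es Er; trivial.
  - destruct B; f_equal; eapply tsubst_ext; eauto.
  - destruct B; f_equal; eapply tsubst_ext; eauto.
  - destruct B; f_equal; [eapply tsubst_ext; eauto|auto].
  - destruct B; f_equal; eauto.
  - f_equal. eapply IHphi; [exact B| |exact Er].
    intros [|i] Hi; simpl; trivial. rewrite Es by lia. reflexivity.
  - f_equal. eapply IHphi; [exact B|exact Es|].
    intros [|i] Hi; simpl; trivial. rewrite Er by lia. reflexivity.
Qed.

(** * Derivations *)

Lemma prv_weak T G phi : prv T G phi -> forall G', incl G G' -> prv T G' phi.
Proof.
  induction 1; intros G' HG.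
  - apply prv_ax; assumption.
  - apply prv_hyp; auto.
  - apply prv_impI. apply IHprv. intros x [<-|Hx]; [left|right]; auto.
  - eapply prv_impE; eauto.
  - apply prv_raa. apply IHprv. intros x [<-|Hx]; [left|right]; auto.
  - apply prv_all1I. apply IHprv. apply incl_map, HG.
  - apply prv_all1E; auto.
  - apply prv_all2I. apply IHprv. apply incl_map, HG.
  - apply prv_all2E; auto.
  - apply prv_refl.
  - eapply prv_leibniz; eauto.
Qed.

Lemma prv_weak_nil T G phi : prv T [] phi -> prv T G phi.
Proof. intro H. eapply prv_weak; [exact H|]. intros x []. Qed.

Definition closure1 (n : nat) (phi : form) : form := Nat.iter n all1 phi.
Definition closure2 (n : nat) (phi : form) : form := Nat.iter n all2 phi.

Lemma prv_closure1 T n phi : prv T [] phi -> prv T [] (closure1 n phi).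
Proof. intro H. induction n; simpl; trivial. apply prv_all1I. exact IHn. Qed.

Lemma prv_closure2 T n phi : prv T [] phi -> prv T [] (closure2 n phi).
Proof. intro H. induction n; simpl; trivial. apply prv_all2I. exact IHn. Qed.

Lemma subst_closure1 n : forall s r phi,
  subst s r (closure1 n phi) = closure1 n (subst (Nat.iter n up1 s) r phi).
Proof.
  induction n; intros; simpl; trivial. f_equal. rewrite IHn.
  f_equal. f_equal. clear. revert s. induction n; intro s; simpl; trivial.
  f_equal. apply IHn.
Qed.

Lemma subst_closure2 n : forall s r phi,
  subst s r (closure2 n phi) = closure2 n (subst s (Nat.iter n up2 r) phi).
Proof.
  induction n; intros; simpl; trivial. f_equal. rewrite IHn.
  f_equal. f_equal. clear. revert r. induction n; intro r; simpl; trivial.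
  f_equal. apply IHn.
Qed.

Lemma iter_up1 n : forall s i,
  Nat.iter n up1 s i = if i <? n then var i else lift n (s (i - n)).
Proof.
  induction n; intros s i; simpl.
  - rewrite Nat.sub_0_r. symmetry. apply tsubst_id.
  - destruct i as [|i]; simpl; trivial.
    rewrite IHn. change (S i <? S n) with (i <? n).
    destruct (i <? n); trivial.
    unfold lift. rewrite tsubst_comp. reflexivity.
Qed.

Lemma iter_up2 n : forall r i,
  Nat.iter n up2 r i = if i <? n then i else n + r (i - n).
Proof.
  induction n; intros r i; simpl.
  - rewrite Nat.sub_0_r. reflexivity.
  - destruct i as [|i]; simpl; trivial.
    rewrite IHn. change (S i <? S n) with (i <? n).
    destruct (i <? n); trivial.
Qed.

(** The instances are taken from the outside in. A term that is substituted for
    an outer variable has been lifted past the inner ones; hence it is read off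
    unchanged when these are instantiated in turn. *)
Lemma prv_closure1_inst T n (s : nat -> term) : forall phi,
  prv T [] (closure1 n phi) ->
  prv T [] (subst (fun i => if i <? n then s i else var (i - n)) (fun X => X) phi).
Proof.
  induction n; intros phi H.
  - simpl in H. replace (subst _ _ phi) with phi; trivial.
    rewrite <- (subst_id phi) at 1. f_equal.
    apply functional_extensionality; intro i. now rewrite Nat.sub_0_r.
  - simpl in H. apply (prv_all1E (s n)) in H.
    rewrite inst1_subst, subst_closure1 in H. apply IHn in H.
    rewrite subst_comp in H. replace (subst _ _ phi) with
      (subst (fun i => tsubst (fun i => if i <? n then s i else var (i - n))
         (Nat.iter n up1 (scons (s n) var) i)) (fun X => X) phi); trivial.
    f_equal. apply functional_extensionality; intro i. rewrite iter_up1.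
    destruct (Nat.ltb_spec i n), (Nat.ltb_spec i (S n)); try lia; simpl.
    + destruct (Nat.ltb_spec i n); [trivial|lia].
    + unfold lift. rewrite tsubst_comp. replace i with n by lia.
      rewrite Nat.sub_diag; simpl. rewrite <- (tsubst_id (s n)) at 2.
      f_equal. apply functional_extensionality; intro j.
      destruct (Nat.ltb_spec (n + j) n); [lia|]. f_equal; lia.
    + unfold lift. rewrite tsubst_comp.
      replace (i - n) with (S (i - S n)) by lia. simpl.
      destruct (Nat.ltb_spec (n + (i - S n)) n); [lia|]. f_equal; lia.
Qed.

Lemma prv_closure2_inst T n (r : nat -> nat) : forall phi,
  prv T [] (closure2 n phi) ->
  prv T [] (subst var (fun i => if i <? n then r i else i - n) phi).
Proof.
  induction n; intros phi H.
  - simpl in H. replace (subst _ _ phi) with phi; trivial.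
    rewrite <- (subst_id phi) at 1. f_equal.
    apply functional_extensionality; intro i. now rewrite Nat.sub_0_r.
  - simpl in H. apply (prv_all2E (r n)) in H.
    rewrite inst2_subst, subst_closure2 in H. apply IHn in H.
    rewrite subst_comp in H. replace (subst _ _ phi) with
      (subst (fun i => tsubst var (var i)) (fun i =>
         let j := Nat.iter n up2 (scons (r n) (fun X => X)) i in
         if j <? n then r j else j - n) phi); trivial.
    f_equal. apply functional_extensionality; intro i. cbv zeta. rewrite iter_up2.
    destruct (Nat.ltb_spec i n), (Nat.ltb_spec i (S n)); try lia; simpl.
    + destruct (Nat.ltb_spec i n); [trivial|lia].
    + replace i with n by lia. rewrite Nat.sub_diag; simpl.
      destruct (Nat.ltb_spec (n + r n) n); lia.
    + replace (i - n) with (S (i - S n)) by lia. simpl.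
      destruct (Nat.ltb_spec (n + (i - S n)) n); lia.
Qed.

(** Simultaneous substitution is derivable when there are no hypotheses:
    generalize the finitely many free variables, then instantiate them one after
    the other. *)
Lemma prv_nil_subst T phi s r : prv T [] phi -> prv T [] (subst s r phi).
Proof.
  intro H. destruct (bounded_exists phi) as [n Hn].
  apply (prv_closure1 n) in H. apply (prv_closure1_inst n s) in H.
  apply (prv_closure2 n) in H. apply (prv_closure2_inst n r) in H.
  rewrite subst_comp in H. erewrite subst_ext; [exact H|exact Hn| |].
  - intros i Hi. cbv beta. destruct (Nat.ltb_spec i n); [|lia].
    symmetry; apply tsubst_id.
  - intros i Hi. cbv beta. destruct (Nat.ltb_spec i n); [trivial|lia].
Qed.

(** Substitution may fail to preserve axioms, but by the previous lemma it
    preserves what they prove. *)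
Lemma prv_subst T G phi : prv T G phi ->
  forall s r, prv T (map (subst s r) G) (subst s r phi).
Proof.
  induction 1; intros s r.
  - apply prv_weak_nil, prv_nil_subst, prv_ax. assumption.
  - apply prv_hyp, in_map. assumption.
  - apply prv_impI, IHprv.
  - eapply prv_impE; [apply IHprv1|apply IHprv2].
  - apply prv_raa, IHprv.
  - simpl. apply prv_all1I. specialize (IHprv (up1 s) r).
    rewrite map_map in *. erewrite map_ext; [exact IHprv|].
    intro; symmetry; apply subst_shift1.
  - rewrite subst_inst1. apply prv_all1E, IHprv.
  - simpl. apply prv_all2I. specialize (IHprv s (up2 r)).
    rewrite map_map in *. erewrite map_ext; [exact IHprv|].
    intro; symmetry; apply subst_shift2.
  - rewrite subst_inst2. apply prv_all2E, IHprv.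
  - apply prv_refl.
  - rewrite subst_inst1. eapply prv_leibniz; [apply IHprv1|].
    rewrite <- subst_inst1. apply IHprv2.
Qed.

Lemma prv_exfalso T G phi : prv T G bot -> prv T G phi.
Proof.
  intro H. apply prv_raa. eapply prv_weak; [exact H|]. intros x Hx; right; exact Hx.
Qed.

(** * Models *)

(** The sets of a model are numbered, and its numbers are enumerated by [name]:
    countable models suffice for completeness, and in them every parameter is
    the value of some variable. *)
Record model := {
  dom :> Type;
  mzero : dom; mone : dom;
  mplus : dom -> dom -> dom; mmult : dom -> dom -> dom;
  mlt : dom -> dom -> Prop;
  mmem : dom -> nat -> Prop;
  name : nat -> dom;
  name_surj : forall a, exists i, name i = a }.

Fixpoint teval (M : model) (e : nat -> M) (t : term) : M :=
  match t with
  | var n => e n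
  | zero => mzero M
  | one => mone M
  | plus t u => mplus M (teval M e t) (teval M e u)
  | mult t u => mmult M (teval M e t) (teval M e u)
  end.

Fixpoint sat (M : model) (e : nat -> M) (E : nat -> nat) (phi : form) : Prop :=
  match phi with
  | bot => False
  | eqn t u => teval M e t = teval M e u
  | ltn t u => mlt M (teval M e t) (teval M e u)
  | mem t X => mmem M (teval M e t) (E X)
  | imp phi psi => sat M e E phi -> sat M e E psi
  | all1 phi => forall x, sat M (scons x e) E phi
  | all2 phi => forall X, sat M e (scons X E) phi
  end.

Definition models (M : model) (T : form -> Prop) : Prop :=
  forall phi, T phi -> forall e E, sat M e E phi.

(** * Completeness *)

Fixpoint terms (n : nat) : list term :=
  match n with
  | 0 => []
  | S n => let l := terms n in
      map var (seq 0 (S n)) ++ zero :: one ::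
      map (fun p => plus (fst p) (snd p)) (list_prod l l) ++
      map (fun p => mult (fst p) (snd p)) (list_prod l l)
  end.

Fixpoint forms (n : nat) : list form :=
  match n with
  | 0 => []
  | S n => let l := forms n in let tt := list_prod (terms n) (terms n) in
      bot ::
      map (fun p => eqn (fst p) (snd p)) tt ++
      map (fun p => ltn (fst p) (snd p)) tt ++
      map (fun p => mem (fst p) (snd p)) (list_prod (terms n) (seq 0 n)) ++
      map (fun p => imp (fst p) (snd p)) (list_prod l l) ++
      map all1 l ++ map all2 l
  end.

Lemma in_pair_map (A B C : Type) (f : A -> B -> C) (l : list A) (l' : list B) a b :
  In a l -> In b l' -> In (f a b) (map (fun p => f (fst p) (snd p)) (list_prod l l')).
Proof. intros. apply in_map_iff. exists (a, b). split; trivial. now apply in_prod. Qed.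

Lemma terms_exhaust t : exists n, forall m, n <= m -> In t (terms m).
Proof.
  induction t as [n| | |t [n Hn] u [m Hm]|t [n Hn] u [m Hm]].
  - exists (S n). intros [|m] H; [lia|]. cbn [terms]. apply in_or_app. left.
    apply in_map, in_seq. lia.
  - exists 1. intros [|m] H; [lia|]. cbn [terms]. apply in_or_app. right. now left.
  - exists 1. intros [|m] H; [lia|]. cbn [terms]. apply in_or_app. right. right. now left.
  - exists (S (n + m)). intros [|k] H; [lia|]. cbn [terms]. apply in_or_app. right.
    right. right. apply in_or_app. left. apply in_pair_map; [apply Hn|apply Hm]; lia.
  - exists (S (n + m)). intros [|k] H; [lia|]. cbn [terms]. apply in_or_app. right.
    right. right. apply in_or_app. right. apply in_pair_map; [apply Hn|apply Hm]; lia.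
Qed.

Lemma forms_exhaust phi : exists n, forall m, n <= m -> In phi (forms m).
Proof.
  induction phi as [|t u|t u|t X|phi [n Hn] psi [m Hm]|phi [n Hn]|phi [n Hn]].
  - exists 1. intros [|m] H; [lia|]. now left.
  - destruct (terms_exhaust t) as [n Hn], (terms_exhaust u) as [m Hm].
    exists (S (n + m)). intros [|k] H; [lia|]. cbn [forms]. right.
    apply in_or_app. left. apply in_pair_map; [apply Hn|apply Hm]; lia.
  - destruct (terms_exhaust t) as [n Hn], (terms_exhaust u) as [m Hm].
    exists (S (n + m)). intros [|k] H; [lia|]. cbn [forms]. right.
    do 1 (apply in_or_app; right).
    apply in_or_app. left. apply in_pair_map; [apply Hn|apply Hm]; lia.
  - destruct (terms_exhaust t) as [n Hn].
    exists (S (S (n + X))). intros [|k] H; [lia|]. cbn [forms]. right.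
    do 2 (apply in_or_app; right).
    apply in_or_app. left. apply in_pair_map; [apply Hn; lia|apply in_seq; lia].
  - exists (S (n + m)). intros [|k] H; [lia|]. cbn [forms]. right.
    do 3 (apply in_or_app; right).
    apply in_or_app. left. apply in_pair_map; [apply Hn|apply Hm]; lia.
  - exists (S n). intros [|k] H; [lia|]. cbn [forms]. right.
    do 4 (apply in_or_app; right).
    apply in_or_app. left. apply in_map, Hn. lia.
  - exists (S n). intros [|k] H; [lia|]. cbn [forms]. right.
    do 5 (apply in_or_app; right). apply in_map, Hn. lia.
Qed.

Definition enum_form (n : nat) : form :=
  nth (fst (Cantor.of_nat n)) (forms (snd (Cantor.of_nat n))) bot.

Lemma enum_form_surj phi : exists n, enum_form n = phi.
Proof.
  destruct (forms_exhaust phi) as [n Hn].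
  destruct (In_nth _ _ bot (Hn n (le_n n))) as [i [_ Hi]].
  exists (Cantor.to_nat (i, n)). unfold enum_form.
  rewrite Cantor.cancel_of_to. exact Hi.
Qed.

Definition enum_term (n : nat) : term :=
  nth (fst (Cantor.of_nat n)) (terms (snd (Cantor.of_nat n))) zero.

Lemma enum_term_surj t : exists n, enum_term n = t.
Proof.
  destruct (terms_exhaust t) as [n Hn].
  destruct (In_nth _ _ zero (Hn n (le_n n))) as [i [_ Hi]].
  exists (Cantor.to_nat (i, n)). unfold enum_term.
  rewrite Cantor.cancel_of_to. exact Hi.
Qed.

Section Henkin.

Variable T : form -> Prop.

Definition consistent (G : list form) : Prop := ~ prv T G bot.

Definition fresh (G : list form) : nat :=
  epsilon (inhabits 0) (fun n => forall phi, In phi G -> bounded n n phi).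

Lemma fresh_bounded G phi : In phi G -> bounded (fresh G) (fresh G) phi.
Proof.
  assert (H : exists n, forall phi, In phi G -> bounded n n phi).
  { clear phi. induction G as [|psi G [n Hn]].
    - exists 0. intros phi [].
    - destruct (bounded_exists psi) as [m Hm]. exists (n + m).
      intros phi [<-|Hphi].
      + eapply bounded_mono; [| |exact Hm]; lia.
      + eapply bounded_mono; [| |apply Hn, Hphi]; lia. }
  exact (epsilon_spec (inhabits 0) _ H phi).
Qed.

(** Henkin's construction needs no new constants: stages are finite lists of
    formulas, so that a variable that is fresh for the stage can name the
    counterexample to a refuted universal formula. *)
Definition witness (G : list form) (phi : form) : list form :=
  match phi with
  | imp (all1 psi) bot => [¬ inst1 (var (fresh (phi :: G))) psi]
  | imp (all2 psi) bot => [¬ inst2 (fresh (phi :: G)) psi]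
  | _ => []
  end.

Definition extend (G : list form) (phi : form) : list form :=
  if excluded_middle_informative (consistent (phi :: G))
  then witness G phi ++ phi :: G else G.

Lemma prv_neg_elim G phi : prv T G phi -> prv T G (¬ phi) -> prv T G bot.
Proof. intros H H'. exact (prv_impE H' H). Qed.

Lemma map_subst_fresh1 G : 
  map (subst (fun i => if i =? fresh G then var 0 else var (S i)) (fun X => X)) G
  = map shift1 G.
Proof.
  apply map_ext_in. intros phi Hphi.
  eapply subst_ext; [apply fresh_bounded, Hphi| |trivial].
  intros i Hi. destruct (Nat.eqb_spec i (fresh G)); [lia|trivial].
Qed.

Lemma map_subst_fresh2 G : 
  map (subst var (fun i => if i =? fresh G then 0 else S i)) G = map shift2 G.
Proof.
  apply map_ext_in. intros phi Hphi.
  eapply subst_ext; [apply fresh_bounded, Hphi|trivial|].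
  intros i Hi. destruct (Nat.eqb_spec i (fresh G)); [lia|trivial].
Qed.

(** A derivation of a contradiction from the witness would, with the witness
    renamed into the variable of the generalization rule, prove the universal
    formula that is refuted. *)
Lemma consistent_witness1 G psi :
  let phi := ¬ ∀¹ psi in
  consistent (phi :: G) ->
  consistent ((¬ inst1 (var (fresh (phi :: G))) psi) :: phi :: G).
Proof.
  intros phi C H. apply C. eapply prv_neg_elim; [|apply prv_hyp; now left].
  apply prv_all1I, prv_raa. set (x := fresh (phi :: G)) in *.
  apply (fun H => prv_subst H
    (fun i => if i =? x then var 0 else var (S i)) (fun X => X)) in H.
  cbn [map] in H. change (subst ?s ?r phi :: map ?f G) with (map f (phi :: G)) in H.
  unfold x in H. rewrite map_subst_fresh1 in H. fold x in H.
  replace (subst _ _ (¬ inst1 (#x) psi)) with (¬ psi) in H; [exact H|].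
  unfold Neg. cbn [subst]. f_equal. rewrite inst1_subst, subst_comp. rewrite <- (subst_id psi) at 1.
  assert (B : bounded x x phi) by (apply fresh_bounded; now left).
  destruct B as [B _]. cbn in B.
  eapply subst_ext; [exact B| |trivial].
  intros [|i] Hi; cbn; [now rewrite Nat.eqb_refl|].
  destruct (Nat.eqb_spec i x); [lia|trivial].
Qed.

Lemma consistent_witness2 G psi :
  let phi := ¬ ∀² psi in
  consistent (phi :: G) ->
  consistent ((¬ inst2 (fresh (phi :: G)) psi) :: phi :: G).
Proof.
  intros phi C H. apply C. eapply prv_neg_elim; [|apply prv_hyp; now left].
  apply prv_all2I, prv_raa. set (x := fresh (phi :: G)) in *.
  apply (fun H => prv_subst H var (fun i => if i =? x then 0 else S i)) in H.
  cbn [map] in H. change (subst ?s ?r phi :: map ?f G) with (map f (phi :: G)) in H.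
  unfold x in H. rewrite map_subst_fresh2 in H. fold x in H.
  replace (subst _ _ (¬ inst2 x psi)) with (¬ psi) in H; [exact H|].
  unfold Neg. cbn [subst]. f_equal. rewrite inst2_subst, subst_comp. rewrite <- (subst_id psi) at 1.
  assert (B : bounded x x phi) by (apply fresh_bounded; now left).
  destruct B as [B _]. cbn in B.
  eapply subst_ext; [exact B|trivial|].
  intros [|i] Hi; cbn; [now rewrite Nat.eqb_refl|].
  destruct (Nat.eqb_spec i x); [lia|trivial].
Qed.

Lemma consistent_extend G phi : consistent G -> consistent (extend G phi).
Proof.
  intro C. unfold extend. destruct excluded_middle_informative as [C'|]; trivial.
  unfold witness. destruct phi as [| | | |[] []| |]; trivial.
  - apply consistent_witness1, C'.
  - apply consistent_witness2, C'.
Qed.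

Variable phi0 : form.
Hypothesis unprovable : ~ prv T [] phi0.

Fixpoint stage (n : nat) : list form :=
  match n with
  | 0 => [¬ phi0]
  | S n => extend (stage n) (enum_form n)
  end.

Lemma stage_consistent n : consistent (stage n).
Proof.
  induction n; simpl; [|apply consistent_extend, IHn].
  intro H. apply unprovable, prv_raa, H.
Qed.

Lemma stage_mono n m : n <= m -> incl (stage n) (stage m).
Proof.
  induction 1; [apply incl_refl|]. eapply incl_tran; [exact IHle|].
  simpl. unfold extend. destruct excluded_middle_informative; [|apply incl_refl].
  apply incl_appr, incl_tl, incl_refl.
Qed.

(** The formulas derivable from some stage form a complete theory with
    witnesses, which is the theory of the term model below. *)
Definition th (phi : form) : Prop := exists n, prv T (stage n) phi.

Lemma th_lift (phi : form) : (forall G, prv T G phi) -> th phi.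
Proof. intro H. exists 0. apply H. Qed.

Lemma th_lift1 phi psi : (forall G, prv T G phi -> prv T G psi) -> th phi -> th psi.
Proof. intros H [n Hn]. exists n. auto. Qed.

Lemma th_lift2 phi psi chi : (forall G, prv T G phi -> prv T G psi -> prv T G chi) ->
  th phi -> th psi -> th chi.
Proof.
  intros H [n Hn] [m Hm]. exists (n + m). apply H.
  - eapply prv_weak; [exact Hn|apply stage_mono; lia].
  - eapply prv_weak; [exact Hm|apply stage_mono; lia].
Qed.

Lemma th_bot : ~ th bot.
Proof. intros [n Hn]. exact (stage_consistent n Hn). Qed.

Lemma th_neg phi : th (¬ phi) <-> ~ th phi.
Proof.
  split.
  - intros H H'. apply th_bot. revert H' H. apply th_lift2. intros G. apply prv_neg_elim.
  - intro H. destruct (enum_form_surj phi) as [n Hn].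
    exists n. apply prv_impI. apply NNPP. intro C. apply H.
    exists (S n). apply prv_hyp. simpl. rewrite Hn. unfold extend.
    destruct excluded_middle_informative; [|contradiction].
    apply in_or_app. right. now left.
Qed.

Lemma th_imp phi psi : th (phi ⟶ psi) <-> (th phi -> th psi).
Proof.
  split.
  - apply th_lift2. intros G. apply prv_impE.
  - intro H. destruct (classic (th phi)) as [Hp|Hp].
    + revert Hp. intro Hp. generalize (H Hp). apply th_lift1. intros G Hpsi.
      apply prv_impI. eapply prv_weak; [exact Hpsi|apply incl_tl, incl_refl].
    + apply th_neg in Hp. revert Hp. apply th_lift1. intros G HG.
      apply prv_impI, prv_exfalso. eapply prv_neg_elim; [apply prv_hyp; now left|].
      eapply prv_weak; [exact HG|apply incl_tl, incl_refl].
Qed.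

Lemma th_witness phi G' n : th phi -> enum_form n = phi ->
  G' = witness (stage n) phi -> incl G' (stage (S n)).
Proof.
  intros H Hn ->. simpl. rewrite Hn. unfold extend.
  destruct excluded_middle_informative as [C|C].
  - apply incl_appl, incl_refl.
  - exfalso. apply NNPP in C. revert H. apply th_neg. exists n. apply prv_impI, C.
Qed.

(** If the universal formula were refuted, the stage that decides its negation
    would contain a counterexample. *)
Lemma th_all1 phi : th (∀¹ phi) <-> forall t, th (inst1 t phi).
Proof.
  split.
  - intros H t. revert H. apply th_lift1. intros G. apply prv_all1E.
  - intro H. apply NNPP. intro Hn. apply th_neg in Hn.
    destruct (enum_form_surj (¬ ∀¹ phi)) as [n E].
    pose proof (th_witness n Hn E eq_refl) as W. cbn [witness] in W.
    apply th_bot. eapply th_lift2; [intros G; apply prv_neg_elim|apply H|].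
    exists (S n). apply prv_hyp, W. now left.
Qed.

Lemma th_all2 phi : th (∀² phi) <-> forall Y, th (inst2 Y phi).
Proof.
  split.
  - intros H t. revert H. apply th_lift1. intros G. apply prv_all2E.
  - intro H. apply NNPP. intro Hn. apply th_neg in Hn.
    destruct (enum_form_surj (¬ ∀² phi)) as [n E].
    pose proof (th_witness n Hn E eq_refl) as W. cbn [witness] in W.
    apply th_bot. eapply th_lift2; [intros G; apply prv_neg_elim|apply H|].
    exists (S n). apply prv_hyp, W. now left.
Qed.

Lemma th_leibniz phi t u : th (t ≐ u) ->
  th (subst (scons t var) (fun X => X) phi) ->
  th (subst (scons u var) (fun X => X) phi).
Proof.
  rewrite <- !inst1_subst. apply th_lift2. intros G. apply prv_leibniz.
Qed.

Lemma th_refl t : th (t ≐ t).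
Proof. apply th_lift. intro. apply prv_refl. Qed.

Lemma tsubst_scons_lift t u : tsubst (scons u var) (lift 1 t) = t.
Proof. unfold lift. rewrite tsubst_comp. apply tsubst_id. Qed.

Lemma th_sym t u : th (t ≐ u) -> th (u ≐ t).
Proof.
  intro H. generalize (th_leibniz (#0 ≐ lift 1 t) H). cbn.
  rewrite !tsubst_scons_lift. intro K. apply K, th_refl.
Qed.

Lemma th_trans t u v : th (t ≐ u) -> th (u ≐ v) -> th (t ≐ v).
Proof.
  intros H H'. generalize (th_leibniz (lift 1 t ≐ #0) H'). cbn.
  rewrite !tsubst_scons_lift. auto.
Qed.

(** Choosing one term from each class of provably equal terms turns equality in
    the term model into identity. *)
Definition rep (t : term) : term := epsilon (inhabits zero) (fun u => th (t ≐ u)).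

Lemma th_rep t : th (t ≐ rep t).
Proof. apply (epsilon_spec (inhabits zero) (fun u => th (t ≐ u))). exists t. apply th_refl. Qed.

Lemma rep_eq t u : th (t ≐ u) <-> rep t = rep u.
Proof.
  split.
  - intro H. unfold rep. f_equal. apply functional_extensionality; intro v.
    apply propositional_extensionality. split; intro H'.
    + eapply th_trans; [apply th_sym, H|exact H'].
    + eapply th_trans; eassumption.
  - intro H. eapply th_trans; [apply th_rep|]. rewrite H. apply th_sym, th_rep.
Qed.

Definition cls (t : term) : {t | rep t = t} :=
  exist _ (rep t) (proj1 (rep_eq (rep t) t) (th_sym (th_rep t))).

Lemma cls_eq t u : cls t = cls u <-> th (t ≐ u).
Proof.
  rewrite rep_eq. split; intro H.
  - exact (f_equal (@proj1_sig _ _) H).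
  - unfold cls. apply eq_sig_hprop; [intros; apply proof_irrelevance|exact H].
Qed.

Lemma cls_surj (d : {t | rep t = t}) : cls (proj1_sig d) = d.
Proof.
  destruct d as [t Ht]. apply eq_sig_hprop; [intros; apply proof_irrelevance|exact Ht].
Qed.

Lemma th_rep_subst t phi :
  th (subst (scons (rep t) var) (fun X => X) phi) <->
  th (subst (scons t var) (fun X => X) phi).
Proof. split; apply th_leibniz; [apply th_sym|]; apply th_rep. Qed.

Lemma cls_enum_surj (a : {t | rep t = t}) : exists n, cls (enum_term n) = a.
Proof.
  destruct (enum_term_surj (proj1_sig a)) as [n Hn].
  exists n. rewrite Hn. apply cls_surj.
Qed.

Definition term_model : model := {|
  dom := {t | rep t = t};
  mzero := cls zero; mone := cls one;
  mplus := fun a b => cls (proj1_sig a ⊕ proj1_sig b);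
  mmult := fun a b => cls (proj1_sig a ⊗ proj1_sig b);
  mlt := fun a b => th (proj1_sig a ≺ proj1_sig b);
  mmem := fun a X => th (proj1_sig a ∈ X);
  name := fun n => cls (enum_term n);
  name_surj := cls_enum_surj |}.

Lemma teval_term_model s t :
  teval term_model (fun i => cls (s i)) t = cls (tsubst s t).
Proof.
  induction t; simpl; trivial; rewrite IHt1, IHt2; apply cls_eq; simpl.
  - eapply th_trans.
    + generalize (th_leibniz (#0 ⊕ lift 1 (rep (tsubst s t2)) ≐
        lift 1 (tsubst s t1) ⊕ lift 1 (rep (tsubst s t2))) (th_rep (tsubst s t1))).
      cbn. rewrite !tsubst_scons_lift. intro H. apply H, th_refl.
    + generalize (th_leibniz (lift 1 (tsubst s t1) ⊕ #0 ≐
        lift 1 (tsubst s t1) ⊕ lift 1 (tsubst s t2)) (th_rep (tsubst s t2))).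
      cbn. rewrite !tsubst_scons_lift. intro H. apply H, th_refl.
  - eapply th_trans.
    + generalize (th_leibniz (#0 ⊗ lift 1 (rep (tsubst s t2)) ≐
        lift 1 (tsubst s t1) ⊗ lift 1 (rep (tsubst s t2))) (th_rep (tsubst s t1))).
      cbn. rewrite !tsubst_scons_lift. intro H. apply H, th_refl.
    + generalize (th_leibniz (lift 1 (tsubst s t1) ⊗ #0 ≐
        lift 1 (tsubst s t1) ⊗ lift 1 (tsubst s t2)) (th_rep (tsubst s t2))).
      cbn. rewrite !tsubst_scons_lift. intro H. apply H, th_refl.
Qed.

Lemma th_ltn_rep t u : th (rep t ≺ rep u) <-> th (t ≺ u).
Proof.
  generalize (th_rep_subst t (#0 ≺ lift 1 (rep u))) (th_rep_subst u (lift 1 t ≺ #0)).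
  cbn. rewrite !tsubst_scons_lift. tauto.
Qed.

(** Truth in the term model is derivability. The assignments range over
    substitutions, since each element of the model is the class of a term. *)
Lemma sat_term_model phi : forall s r,
  sat term_model (fun i => cls (s i)) r phi <-> th (subst s r phi).
Proof.
  induction phi; intros s r; simpl.
  - split; [contradiction|apply th_bot].
  - rewrite !teval_term_model. apply cls_eq.
  - rewrite !teval_term_model. simpl. apply th_ltn_rep.
  - rewrite !teval_term_model. simpl.
    exact (th_rep_subst (tsubst s t) (#0 ∈ r X)).
  - rewrite IHphi1, IHphi2, th_imp. reflexivity.
  - rewrite th_all1. split.
    + intros H t. rewrite inst1_up1. apply IHphi. specialize (H (cls t)).
      replace (fun i => cls (scons t s i)) with (scons (cls t) (fun i => cls (s i)));
        [exact H|]. apply functional_extensionality. intros [|i]; reflexivity.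
    + intros H d. specialize (H (proj1_sig d)). rewrite inst1_up1 in H.
      apply IHphi in H. rewrite <- (cls_surj d).
      replace (scons (cls (proj1_sig d)) (fun i => cls (s i)))
        with (fun i => cls (scons (proj1_sig d) s i)); [exact H|].
      apply functional_extensionality. intros [|i]; reflexivity.
  - rewrite th_all2. split.
    + intros H Y. rewrite inst2_up2. apply IHphi, H.
    + intros H Y. specialize (H Y). rewrite inst2_up2 in H. apply IHphi, H.
Qed.

Lemma term_model_models : models term_model T.
Proof.
  intros phi Hphi e E.
  replace e with (fun i => cls (proj1_sig (e i)))
    by (apply functional_extensionality; intro; apply cls_surj).
  apply sat_term_model. exists 0. apply prv_weak_nil, prv_nil_subst, prv_ax, Hphi.
Qed.

Lemma term_model_refutes :
  ~ sat term_model (fun i => cls (var i)) (fun X => X) phi0.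
Proof.
  intro H. apply sat_term_model in H. rewrite subst_id in H. revert H.
  apply th_neg. exists 0. apply prv_hyp. now left.
Qed.

End Henkin.

(** The free variables of axioms are read universally both in derivations and
    in [models], so the term model of an unprovable formula satisfies [T] and
    refutes the formula. *)
Theorem completeness (T : form -> Prop) (phi : form) :
  (forall M, models M T -> forall e E, sat M e E phi) -> proves T phi.
Proof.
  intro H. apply NNPP. intro U.
  apply (term_model_refutes U). apply H. apply (term_model_models U).
Qed.

Unset Strict Implicit.

(** * Truth of formulas *)

Lemma sat_And M e E phi psi : sat M e E (phi ⋏ psi) <-> sat M e E phi /\ sat M e E psi.
Proof. simpl. tauto. Qed.

Lemma sat_Or M e E phi psi : sat M e E (phi ⋎ psi) <-> sat M e E phi \/ sat M e E psi.
Proof. simpl. tauto. Qed.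

Lemma sat_Iff M e E phi psi :
  sat M e E (phi ⟷ psi) <-> (sat M e E phi <-> sat M e E psi).
Proof. simpl. tauto. Qed.

Lemma sat_ex1 M e E phi : sat M e E (∃¹ phi) <-> exists x, sat M (scons x e) E phi.
Proof.
  simpl. split.
  - intro H. apply NNPP. intro N. apply H. intros x Hx. apply N. exists x; exact Hx.
  - intros [x Hx] H. exact (H x Hx).
Qed.

Lemma sat_ex2 M e E phi : sat M e E (∃² phi) <-> exists X, sat M e (scons X E) phi.
Proof.
  simpl. split.
  - intro H. apply NNPP. intro N. apply H. intros x Hx. apply N. exists x; exact Hx.
  - intros [x Hx] H. exact (H x Hx).
Qed.

Lemma teval_tsubst M e s t :
  teval M e (tsubst s t) = teval M (fun i => teval M e (s i)) t.
Proof. induction t; simpl; congruence. Qed.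

Lemma teval_lift1 M e x t : teval M (scons x e) (lift 1 t) = teval M e t.
Proof. unfold lift. rewrite teval_tsubst. reflexivity. Qed.

Lemma sat_subst M phi : forall e E s r,
  sat M e E (subst s r phi) <->
  sat M (fun i => teval M e (s i)) (fun X => E (r X)) phi.
Proof.
  induction phi; intros e E s r; simpl; rewrite ?teval_tsubst; try reflexivity.
  - rewrite IHphi1, IHphi2. reflexivity.
  - apply Morphisms_Prop.all_iff_morphism. intro x. rewrite IHphi.
    replace (fun i => teval M (scons x e) (up1 s i))
      with (scons x (fun i => teval M e (s i))); [reflexivity|].
    apply functional_extensionality. intros [|i]; simpl; trivial.
    now rewrite teval_lift1.
  - apply Morphisms_Prop.all_iff_morphism. intro X. rewrite IHphi.
    replace (fun Y => scons X E (up2 r Y)) with (scons X (fun Y => E (r Y)));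
      [reflexivity|].
    apply functional_extensionality. intros [|i]; reflexivity.
Qed.

Declare Scope M_scope.
Delimit Scope M_scope with M.
Notation "0" := (mzero _) : M_scope.
Notation "1" := (mone _) : M_scope.
Infix "+" := (mplus _) : M_scope.
Infix "*" := (mmult _) : M_scope.
Infix "<" := (mlt _) : M_scope.
Definition mle (M : model) (x y : M) : Prop := mlt M x y \/ x = y.
Infix "<=" := (@mle _) : M_scope.
Notation "x ∈ X" := (mmem _ x X) : M_scope.
Open Scope M_scope.

(** A class, so that the lemmas about a model find this hypothesis. *)
Class rca0 (M : model) : Prop := rca0_valid : models M RCA0.

Notation env M := (nat -> dom M).

Section Model.

Context {M : model} {HM : rca0 M}.

(** * Arithmetic in a model *)

Lemma semiring_valid phi : semiring_axiom phi -> forall e, sat M e (fun X => X) phi.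
Proof. intros H e. apply rca0_valid, RCA0_semiring, H. Qed.

Let env3 (x y z : M) : nat -> M := scons x (scons y (scons z (fun _ => 0))).

Lemma addA (x y z : M) : (x + y) + z = x + (y + z).
Proof. exact (semiring_valid ax_addA (env3 x y z)). Qed.
Lemma addC (x y : M) : x + y = y + x.
Proof. exact (semiring_valid ax_addC (env3 x y y)). Qed.
Lemma mulA (x y z : M) : (x * y) * z = x * (y * z).
Proof. exact (semiring_valid ax_mulA (env3 x y z)). Qed.
Lemma mulC (x y : M) : x * y = y * x.
Proof. exact (semiring_valid ax_mulC (env3 x y y)). Qed.
Lemma mulDr (x y z : M) : x * (y + z) = x * y + x * z.
Proof. exact (semiring_valid ax_mulDr (env3 x y z)). Qed.
Lemma add0 (x : M) : x + 0 = x.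
Proof. exact (semiring_valid ax_add0 (env3 x x x)). Qed.
Lemma mul0 (x : M) : x * 0 = 0.
Proof. exact (semiring_valid ax_mul0 (env3 x x x)). Qed.
Lemma mul1 (x : M) : x * 1 = x.
Proof. exact (semiring_valid ax_mul1 (env3 x x x)). Qed.

Lemma M_semiring :
  semi_ring_theory (mzero M) (mone M) (mplus M) (mmult M) (@eq M).
Proof.
  constructor; intros.
  - rewrite addC. apply add0.
  - apply addC.
  - symmetry; apply addA.
  - rewrite mulC. apply mul1.
  - rewrite mulC. apply mul0.
  - apply mulC.
  - symmetry; apply mulA.
  - rewrite mulC, mulDr, (mulC p n), (mulC p m). reflexivity.
Qed.

Add Ring M_ring : M_semiring.

Lemma lt_trans (x y z : M) : x < y -> y < z -> x < z.
Proof.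
  intros H1 H2. apply (semiring_valid ax_lt_trans (env3 x y z)).
  apply sat_And. now split.
Qed.
Lemma lt_irrefl (x : M) : ~ x < x.
Proof. exact (semiring_valid ax_lt_irrefl (env3 x x x)). Qed.
Lemma lt_total (x y : M) : x < y \/ x = y \/ y < x.
Proof.
  generalize (semiring_valid ax_lt_total (env3 x y y)). rewrite !sat_Or. trivial.
Qed.
Lemma lt_add (x y z : M) : x < y -> x + z < y + z.
Proof. exact (semiring_valid ax_lt_add (env3 x y z)). Qed.
Lemma lt_mul (x y z : M) : 0 < z -> x < y -> x * z < y * z.
Proof.
  intros H1 H2. apply (semiring_valid ax_lt_mul (env3 x y z)).
  apply sat_And. now split.
Qed.
Lemma lt01 : 0 < (1 : M).
Proof. exact (semiring_valid ax_lt01 (env3 0 0 0)). Qed.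
Lemma discrete (x : M) : 0 < x -> 1 <= x.
Proof.
  intro H. generalize (semiring_valid ax_discrete (env3 x x x) H).
  unfold leq. rewrite sat_Or. trivial.
Qed.
Lemma le_0 (x : M) : 0 <= x.
Proof.
  generalize (semiring_valid ax_le0 (env3 x x x)). unfold leq. rewrite sat_Or. trivial.
Qed.

Lemma le_refl (x : M) : x <= x.
Proof. now right. Qed.
Lemma lt_le (x y : M) : x < y -> x <= y.
Proof. now left. Qed.
Lemma le_lt_trans (x y z : M) : x <= y -> y < z -> x < z.
Proof. intros [H| ->] H'; trivial. exact (lt_trans H H'). Qed.
Lemma lt_le_trans (x y z : M) : x < y -> y <= z -> x < z.
Proof. intros H [H'| <-]; trivial. exact (lt_trans H H'). Qed.
Lemma le_trans (x y z : M) : x <= y -> y <= z -> x <= z.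
Proof. intros [H| ->] H'; trivial. left. exact (lt_le_trans H H'). Qed.
Lemma lt_not_le (x y : M) : x < y -> ~ y <= x.
Proof. intros H H'. exact (lt_irrefl (lt_le_trans H H')). Qed.
Lemma le_or_lt (x y : M) : x <= y \/ y < x.
Proof. unfold mle. destruct (lt_total x y) as [H|[H|H]]; auto. Qed.
Lemma not_lt (x y : M) : ~ x < y <-> y <= x.
Proof.
  split.
  - intro H. destruct (le_or_lt y x); tauto.
  - intros H H'. exact (lt_not_le H' H).
Qed.
Lemma not_le (x y : M) : ~ x <= y <-> y < x.
Proof. rewrite <- not_lt. split; [apply NNPP|tauto]. Qed.
Lemma le_antisym (x y : M) : x <= y -> y <= x -> x = y.
Proof. intros [H|H] H'; trivial. destruct (lt_not_le H H'). Qed.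
Lemma nlt_0 (x : M) : ~ x < 0.
Proof. apply not_lt, le_0. Qed.
Lemma lt_ne (x y : M) : x < y -> x <> y.
Proof. intros H ->. exact (lt_irrefl H). Qed.

Lemma add_cancel (x y z : M) : x + z = y + z -> x = y.
Proof.
  intro H. destruct (lt_total x y) as [K|[K|K]]; trivial;
    apply (lt_add z) in K; rewrite H in K; destruct (lt_irrefl K).
Qed.
Lemma add_lt_cancel (x y z : M) : x + z < y + z -> x < y.
Proof.
  intro H. apply not_le. intros [K| ->].
  - exact (lt_irrefl (lt_trans H (lt_add z K))).
  - exact (lt_irrefl H).
Qed.
Lemma le_exists (x y : M) : x <= y <-> exists z, y = x + z.
Proof.
  split.
  - intros [H| ->].
    + generalize (semiring_valid ax_sub (env3 x y y) H). rewrite sat_ex1.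
      intros [z Hz]. exists z. symmetry. exact Hz.
    + exists 0. ring.
  - intros [z ->]. destruct (le_0 z) as [H| <-].
    + left. apply (lt_add x) in H. replace (0 + x) with x in H by ring.
      now rewrite (addC x z).
    + right. ring.
Qed.
Lemma lt_exists (x y : M) : x < y <-> exists z, y = x + z + 1.
Proof.
  split.
  - intro H. destruct (proj1 (le_exists x y) (lt_le H)) as [z ->].
    assert (K : 0 < z).
    { apply (add_lt_cancel (z := x)). now replace (0 + x) with x by ring;
        replace (z + x) with (x + z) by ring. }
    apply discrete, le_exists in K. destruct K as [w ->]. exists w. ring.
  - intros [z ->]. apply le_lt_trans with (x + z); [apply le_exists; now exists z|].
    generalize (lt_add (x + z) lt01). intro H.
    replace (x + z + 1) with (1 + (x + z)) by ring.
    now replace (0 + (x + z)) with (x + z) in H by ring.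
Qed.
Lemma le_add_r (x y : M) : x <= x + y.
Proof. apply le_exists. now exists y. Qed.
Lemma le_add_l (x y : M) : x <= y + x.
Proof. rewrite addC. apply le_add_r. Qed.
Lemma lt_succ (x y : M) : x < y + 1 <-> x <= y.
Proof.
  split.
  - rewrite lt_exists. intros [z H]. apply add_cancel in H. subst. apply le_add_r.
  - rewrite le_exists, lt_exists. intros [z ->]. now exists z.
Qed.
Lemma lt_S (x : M) : x < x + 1.
Proof. apply lt_succ, le_refl. Qed.
Lemma succ_le (x y : M) : x + 1 <= y <-> x < y.
Proof.
  rewrite le_exists, lt_exists. split; intros [z ->]; exists z; ring.
Qed.
Lemma succ_inj (x y : M) : x + 1 = y + 1 -> x = y.
Proof. apply add_cancel. Qed.
Lemma zero_or_succ (x : M) : x = 0 \/ exists y, x = y + 1.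
Proof.
  destruct (le_0 x) as [H|H]; [right|now left].
  apply lt_exists in H. destruct H as [z ->]. exists z. ring.
Qed.
Lemma lt_0_succ (x : M) : 0 < x + 1.
Proof. apply lt_succ, le_0. Qed.
Lemma le_add (x y x' y' : M) : x <= y -> x' <= y' -> x + x' <= y + y'.
Proof.
  rewrite !le_exists. intros [a ->] [b ->]. exists (a + b). ring.
Qed.
Lemma le_mul (x y x' y' : M) : x <= y -> x' <= y' -> x * x' <= y * y'.
Proof.
  rewrite !le_exists. intros [a ->] [b ->]. exists (x * b + a * x' + a * b). ring.
Qed.
Lemma mul_pos (x y : M) : 0 < x -> 0 < y -> 0 < x * y.
Proof.
  intros H K. generalize (lt_mul K H). replace (0 * y) with (0 : M) by ring. trivial.
Qed.
Definition pair (x y : M) : M := (x + y) * (x + y) + x.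

(** The pair lies between the squares of [x + y] and of its successor, and so
    determines [x + y]. *)
Lemma pair_inj (x y x' y' : M) : pair x y = pair x' y' -> x = x' /\ y = y'.
Proof.
  (* If x' + y' = x + y + d + 1, the difference of the codes is visibly
     positive. *)
  assert (L : forall x y x' y' : M, x + y < x' + y' -> pair x y < pair x' y').
  { clear x y x' y'. unfold pair. intros x y x' y' H. apply lt_exists in H. destruct H as [d ->].
    apply lt_exists. exists (y + (d*d + d*(1+1)*(x+y) + (1+1)*d + x+y) + x' ). ring. }
  intro H. destruct (lt_total (x + y) (x' + y')) as [K|[K|K]].
  - apply L in K. rewrite H in K. destruct (lt_irrefl K).
  - unfold pair in H. rewrite K, !(addC _ x), !(addC _ x') in H. apply add_cancel in H.
    subst x'. split; trivial. rewrite !(addC x) in K. exact (add_cancel K).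
  - apply L in K. rewrite H in K. destruct (lt_irrefl K).
Qed.

Lemma le_mul_self (x : M) : x <= x * x.
Proof.
  destruct (zero_or_succ x) as [->|[y ->]]; [rewrite mul0; apply le_refl|].
  apply le_exists. exists (y * y + y). ring.
Qed.

Lemma pair_le_l (x y : M) : x <= pair x y.
Proof. apply le_add_l. Qed.
Lemma pair_le_r (x y : M) : y <= pair x y.
Proof.
  apply le_trans with (x + y); [apply le_add_l|].
  apply le_trans with ((x + y) * (x + y)); [apply le_mul_self|apply le_add_r].
Qed.
Lemma pair_mono (x y x' y' : M) : x <= x' -> y <= y' -> pair x y <= pair x' y'.
Proof.
  intros H K. unfold pair. apply le_add; trivial. apply le_mul; now apply le_add.
Qed.

(** * Definable predicates *)

Definition tail (e : env M) : env M := fun i => e (S i).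

(** The variables of even index carry the arguments of a predicate, and those of
    odd index name all elements of [M]. Hence a formula over this assignment is
    a formula with arbitrary parameters, and no parameters have to be merged
    when formulas are combined. *)
Definition mix (e : env M) : env M :=
  fun n => if Nat.even n then e (Nat.div2 n) else name M (Nat.div2 n).

Definition holds (e : env M) (phi : form) : Prop := sat M (mix e) (fun X => X) phi.

Definition term_def (t : env M -> M) : Prop :=
  exists u, forall e, t e = teval M (mix e) u.

Lemma mix_even e i : mix e (2 * i) = e i.
Proof.
  unfold mix. rewrite Nat.even_even. now rewrite Nat.div2_double.
Qed.

Lemma mix_odd e i : mix e (2 * i + 1) = name M i.
Proof.
  unfold mix. rewrite Nat.even_odd. rewrite Nat.add_1_r, Nat.div2_succ_double. reflexivity.
Qed.

Lemma term_def_var i : term_def (fun e => e i).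
Proof. exists (var (2 * i)). intro e. symmetry. apply mix_even. Qed.
Lemma term_def_const a : term_def (fun _ => a).
Proof.
  destruct (name_surj M a) as [i Hi]. exists (var (2 * i + 1)). intro e.
  cbn [teval scons]. now rewrite mix_odd.
Qed.
Lemma term_def_plus t u : term_def t -> term_def u -> term_def (fun e => t e + u e).
Proof. intros [a Ha] [b Hb]. exists (a ⊕ b). intro e. simpl. congruence. Qed.
Lemma term_def_mult t u : term_def t -> term_def u -> term_def (fun e => t e * u e).
Proof. intros [a Ha] [b Hb]. exists (a ⊗ b). intro e. simpl. congruence. Qed.

Lemma term_def_tail t : term_def t -> term_def (fun e => t (tail e)).
Proof.
  intros [u Hu].
  exists (tsubst (fun n => if Nat.even n then var (n + 2) else var n) u).
  intro e. rewrite Hu, teval_tsubst. f_equal.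
  apply functional_extensionality. intro n.
  destruct (Nat.Even_or_Odd n) as [[j ->]|[j ->]].
  - rewrite mix_even, Nat.even_even. cbn [teval].
    replace (2 * j + 2)%nat with (2 * S j)%nat by lia. now rewrite mix_even.
  - rewrite mix_odd, Nat.even_odd. cbn [teval]. now rewrite mix_odd.
Qed.

Definition Def0 (P : env M -> Prop) : Prop :=
  exists phi, Sigma00 phi /\ forall e, P e <-> holds e phi.

Lemma Def0_ext (P Q : env M -> Prop) : (forall e, P e <-> Q e) -> Def0 P -> Def0 Q.
Proof.
  intros H [phi [S K]]. exists phi. split; trivial. intro e. now rewrite <- H.
Qed.

Lemma Def0_bot : Def0 (fun _ => False).
Proof. exists bot. split; [constructor|reflexivity]. Qed.
Lemma Def0_eq t u : term_def t -> term_def u -> Def0 (fun e => t e = u e).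
Proof.
  intros [a Ha] [b Hb]. exists (a ≐ b). split; [constructor|].
  intro e. rewrite Ha, Hb. reflexivity.
Qed.
Lemma Def0_lt t u : term_def t -> term_def u -> Def0 (fun e => t e < u e).
Proof.
  intros [a Ha] [b Hb]. exists (a ≺ b). split; [constructor|].
  intro e. rewrite Ha, Hb. reflexivity.
Qed.
Lemma Def0_mem t X : term_def t -> Def0 (fun e => t e ∈ X).
Proof.
  intros [a Ha]. exists (mem a X). split; [constructor|].
  intro e. rewrite Ha. reflexivity.
Qed.
Lemma Def0_imp P Q : Def0 P -> Def0 Q -> Def0 (fun e => P e -> Q e).
Proof.
  intros [a [Sa Ha]] [b [Sb Hb]]. exists (a ⟶ b). split; [now constructor|].
  intro e. rewrite Ha, Hb. reflexivity.
Qed.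
Lemma Def0_not P : Def0 P -> Def0 (fun e => ~ P e).
Proof. intro H. exact (Def0_imp H Def0_bot). Qed.
Lemma Def0_and P Q : Def0 P -> Def0 Q -> Def0 (fun e => P e /\ Q e).
Proof.
  intros HP HQ. eapply Def0_ext; [|exact (Def0_not (Def0_imp HP (Def0_not HQ)))].
  intro e. tauto.
Qed.
Lemma Def0_or P Q : Def0 P -> Def0 Q -> Def0 (fun e => P e \/ Q e).
Proof.
  intros HP HQ. eapply Def0_ext; [|exact (Def0_imp (Def0_not HP) HQ)].
  intro e. tauto.
Qed.

Lemma Sigma00_subst phi : Sigma00 phi -> forall s r, Sigma00 (subst s r phi).
Proof.
  assert (C : forall s t, tsubst (up1 s) (lift 1 t) = lift 1 (tsubst s t)).
  { intros s t. unfold lift. rewrite !tsubst_comp. reflexivity. }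
  induction 1; intros s r; simpl; try (constructor; auto; fail).
  - rewrite C. apply Sigma00_ball, IHSigma00.
  - rewrite C. apply (Sigma00_bex (tsubst s t)), IHSigma00.
Qed.

(** A quantifier puts its variable in front of [mix e], whereas the class [Def0]
    expects it in front of [e]; this renaming mediates between the two. *)
Definition unmix (i : nat) : term :=
  if Nat.even i then var (i - 1) else var (i + 1).

Lemma holds_scons e x phi :
  sat M (scons x (mix e)) (fun X => X) (subst unmix (fun X => X) phi) <->
  holds (scons x e) phi.
Proof.
  rewrite sat_subst. unfold holds.
  replace (fun i => teval M (scons x (mix e)) (unmix i)) with (mix (scons x e));
    [reflexivity|].
  apply functional_extensionality. intro i. unfold unmix.
  destruct (Nat.Even_or_Odd i) as [[j ->]|[j ->]].
  - rewrite mix_even, Nat.even_even. destruct j as [|j]; [reflexivity|].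
    replace (2 * S j - 1)%nat with (S (2 * j)) by lia.
    cbn [teval scons]. now rewrite mix_even.
  - rewrite mix_odd, Nat.even_odd.
    replace (2 * j + 1 + 1)%nat with (S (2 * j + 1)) by lia.
    cbn [teval scons]. now rewrite mix_odd.
Qed.

(** The quantified predicate receives the environment and the bound number as
    separate arguments, a form that unification recognizes. *)
Lemma Def0_ball (t : env M -> M) (Q : env M -> M -> Prop) :
  term_def t -> Def0 (fun e => Q (tail e) (e O)) ->
  Def0 (fun e => forall x, x < t e -> Q e x).
Proof.
  intros [a Ha] [b [Sb Hb]].
  exists (∀¹ (#0 ≺ lift 1 a ⟶ subst unmix (fun X => X) b)). split.
  - apply Sigma00_ball, Sigma00_subst, Sb.
  - intro e. unfold holds. cbn [sat]. apply Morphisms_Prop.all_iff_morphism. intro x.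
    rewrite holds_scons, <- Hb. cbn [teval scons]. rewrite teval_lift1, <- Ha. reflexivity.
Qed.

Lemma Def0_bex (t : env M -> M) (Q : env M -> M -> Prop) :
  term_def t -> Def0 (fun e => Q (tail e) (e O)) ->
  Def0 (fun e => exists x, x < t e /\ Q e x).
Proof.
  intros Ht HQ.
  eapply Def0_ext;
    [|apply Def0_not, (Def0_ball (t := t) (Q := fun e x => ~ Q e x));
      [exact Ht|apply Def0_not, HQ]].
  intro e. simpl. split.
  - intro H. apply NNPP. intro N. apply H. intros x Hx K. apply N. now exists x.
  - intros [x [Hx K]] H. exact (H x Hx K).
Qed.

Lemma Def0_comp (P : env M -> Prop) (f : env M -> env M) :
  Def0 P -> (forall i, term_def (fun e => f e i)) -> Def0 (fun e => P (f e)).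
Proof.
  intros [a [Sa Ha]] Hf.
  destruct (choice _ Hf) as [g Hg].
  exists (subst (fun n => if Nat.even n then g (Nat.div2 n) else var n) (fun X => X) a).
  split; [apply Sigma00_subst, Sa|].
  intro e. rewrite Ha. unfold holds. rewrite sat_subst.
  replace (fun i => teval M (mix e) (if Nat.even i then g (Nat.div2 i) else #i))
    with (mix (f e)); [reflexivity|].
  apply functional_extensionality. intro i.
  destruct (Nat.Even_or_Odd i) as [[j ->]|[j ->]].
  - rewrite mix_even, Nat.even_even, Nat.div2_double. apply Hg.
  - rewrite Nat.even_odd. cbn [teval scons]. now rewrite !mix_odd.
Qed.

Definition Def1 (P : env M -> Prop) : Prop :=
  exists Q, Def0 Q /\ forall e, P e <-> exists x, Q (scons x e).

Lemma Def1_formula P : Def1 P ->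
  exists phi, Sigma01 phi /\ forall e, P e <-> holds e phi.
Proof.
  intros [Q [[b [Sb Hb]] H]]. exists (∃¹ subst unmix (fun X => X) b). split.
  - eexists. split; [|reflexivity]. apply Sigma00_subst, Sb.
  - intro e. rewrite H. unfold holds. rewrite sat_ex1.
    apply Morphisms_Prop.ex_iff_morphism. intro x. rewrite holds_scons. apply Hb.
Qed.

Lemma Def1_ext (P Q : env M -> Prop) : (forall e, P e <-> Q e) -> Def1 P -> Def1 Q.
Proof.
  intros H [R [S K]]. exists R. split; trivial. intro e. now rewrite <- H.
Qed.

Lemma Def1_Def0 P : Def0 P -> Def1 P.
Proof.
  intro H. exists (fun e => P (tail e)). split.
  - apply (Def0_comp (f := tail) H). intro i. apply term_def_var.
  - intro e. split; [intro K; exists 0; exact K|]. now intros [x K].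
Qed.

Lemma Def1_comp (P : env M -> Prop) (f : env M -> env M) :
  Def1 P -> (forall i, term_def (fun e => f e i)) -> Def1 (fun e => P (f e)).
Proof.
  intros [Q [HQ H]] Hf.
  exists (fun e => Q (scons (e O) (f (tail e)))). split.
  - apply (Def0_comp (f := fun e => scons (e O) (f (tail e))) HQ).
    intros [|i]; [apply term_def_var|exact (term_def_tail (Hf i))].
  - intro e. rewrite H. reflexivity.
Qed.

(** Two unbounded existential quantifiers are one that bounds both. *)
Lemma Def1_ex (Q : env M -> M -> Prop) :
  Def1 (fun e => Q (tail e) (e O)) -> Def1 (fun e => exists x, Q e x).
Proof.
  intros [R [HR H]].
  exists (fun e => exists x, x < e O /\ exists y, y < e O /\
            R (scons y (scons x (tail e)))). split.
  - apply Def0_bex; [apply term_def_var|]. apply Def0_bex; [apply term_def_var|].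
    apply (Def0_comp (f := fun e => scons (e O) (scons (e 1%nat) (tail (tail (tail e))))) HR).
    intros [|[|i]]; apply term_def_var.
  - intro e. split.
    + intros [x Hx]. change (Q (tail (scons x e)) (scons x e O)) in Hx.
      apply H in Hx. destruct Hx as [y Hy]. exists (x + y + 1), x. split.
      { apply lt_succ, le_add_r. }
      exists y. split; [apply lt_succ, le_add_l|exact Hy].
    + intros [z [x [_ [y [_ Hy]]]]]. exists x.
      change (Q (tail (scons x e)) (scons x e O)). apply H. now exists y.
Qed.

Lemma Def1_and P Q : Def1 P -> Def1 Q -> Def1 (fun e => P e /\ Q e).
Proof.
  intros [R [HR HP]] [S [HS HQ]].
  eapply Def1_ext with (P := fun e => exists x, exists y, R (scons x e) /\ S (scons y e)).
  { intro e. rewrite HP, HQ. firstorder. }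
  apply Def1_ex, Def1_ex, Def1_Def0, Def0_and.
  - apply (Def0_comp (f := fun e => scons (e 1%nat) (tail (tail e))) HR).
    intros [|i]; apply term_def_var.
  - apply (Def0_comp (f := fun e => scons (e O) (tail (tail e))) HS).
    intros [|i]; apply term_def_var.
Qed.

Lemma Def1_or P Q : Def1 P -> Def1 Q -> Def1 (fun e => P e \/ Q e).
Proof.
  intros [R [HR HP]] [S [HS HQ]]. exists (fun e => R e \/ S e). split.
  - now apply Def0_or.
  - intro e. rewrite HP, HQ. firstorder.
Qed.

(** What [mix] assigns to the variables other than 0, so that an axiom whose
    distinguished variable is 0 can be evaluated with all parameters. *)
Definition params : env M := tail (mix (fun _ => 0)).

Lemma scons_params (x : M) : scons x params = mix (scons x (fun _ => 0)).
Proof.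
  apply functional_extensionality. intros [|i]; [reflexivity|].
  change (mix (fun _ => 0) (S i) = mix (scons x (fun _ => 0)) (S i)).
  unfold mix. destruct (Nat.even (S i)) eqn:Ev; trivial.
  destruct i; [discriminate|]. reflexivity.
Qed.

Lemma holds_params (P : M -> Prop) phi x : (forall e, P (e O) <-> holds e phi) ->
  (sat M (scons x params) (fun X => X) phi <-> P x).
Proof. intro H. rewrite scons_params. symmetry. exact (H (scons x (fun _ => 0))). Qed.

Theorem Def1_ind (P : M -> Prop) :
  Def1 (fun e => P (e O)) -> P 0 -> (forall x, P x -> P (x + 1)) -> forall x, P x.
Proof.
  intros D H0 HS x. destruct (Def1_formula D) as [phi [Sg H]].
  assert (K := fun y => holds_params y H).
  apply K, (rca0_valid (RCA0_induction Sg) params (fun X => X)), sat_And. split.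
  - unfold inst1. rewrite (sat_subst phi). apply K in H0.
    replace (fun i => teval M params match i with O => zero | S n => #n end)
      with (scons 0 params); [exact H0|].
    apply functional_extensionality. intros [|i]; reflexivity.
  - intros y Hy. apply K, HS, K in Hy. rewrite (sat_subst phi).
    replace (fun i => teval M (scons y params)
        match i with O => #0 ⊕ one | S n => #(S n) end)
      with (scons (y + 1) params); [exact Hy|].
    apply functional_extensionality. intros [|i]; reflexivity.
Qed.

Lemma sat_comprehension_for phi e E :
  sat M e E (comprehension_for phi) <->
  exists X, forall x, x ∈ X <-> sat M (scons x e) E phi.
Proof.
  unfold comprehension_for. rewrite sat_ex2.
  apply Morphisms_Prop.ex_iff_morphism. intro X. cbn [sat].
  apply Morphisms_Prop.all_iff_morphism. intro x. rewrite sat_Iff.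
  unfold shift2. rewrite (sat_subst phi). reflexivity.
Qed.

Theorem Delta1_comprehension (P : M -> Prop) :
  Def1 (fun e => P (e O)) -> Def1 (fun e => ~ P (e O)) ->
  exists X, forall x, x ∈ X <-> P x.
Proof.
  intros D D'. destruct (Def1_formula D) as [phi [Sg H]], (Def1_formula D') as [psi [Sg' H']].
  destruct Sg' as [th [Sg' ->]].
  assert (K := fun y => holds_params y H).
  assert (K' := fun y => holds_params (P := fun x => ~ P x) y H').
  assert (HQ : Pi01 (∀¹ (¬ th))).
  { exists (¬ th). split; [constructor; [trivial|constructor]|reflexivity]. }
  assert (C := rca0_valid (RCA0_comprehension Sg HQ) params (fun X => X)).
  cbn [sat] in C. rewrite sat_comprehension_for in C.
  destruct C as [X HX]; [|exists X; intro x; now rewrite HX, K].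
  intro x. rewrite sat_Iff, K. specialize (K' x). rewrite sat_ex1 in K'. cbn [sat].
  split.
  - intros Px y Hy. apply (proj1 K'); [now exists y|exact Px].
  - intro N. apply NNPP. intro Px. apply K' in Px. destruct Px as [y Hy]. exact (N y Hy).
Qed.

(** This is [Sigma^0_1] bounding: induction on the range of [x] finds a common
    bound for the witnesses. *)
Lemma Def1_ball (Q : env M -> M -> Prop) i :
  Def1 (fun e => Q (tail e) (e O)) ->
  Def1 (fun e => forall x, x < e i -> Q e x).
Proof.
  intros [R [HR H]].
  assert (HQ : forall e x, Q e x <-> exists y, R (scons y (scons x e))).
  { intros e x. apply (H (scons x e)). }
  assert (F : Def0 (fun e => forall x, x < e (S i) -> exists y, y < e O /\
            R (scons y (scons x (tail e))))).
  { apply Def0_ball; [apply term_def_var|]. apply Def0_bex; [apply term_def_var|].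
    apply (Def0_comp (f := fun e => scons (e O) (scons (e 1%nat) (tail (tail (tail e))))) HR).
    intros [|[|j]]; apply term_def_var. }
  exists (fun e => forall x, x < e (S i) -> exists y, y < e O /\
            R (scons y (scons x (tail e)))). split; [exact F|].
  intro e. split.
  - intro K.
    enough (B : forall w, w <= e i -> exists z, forall x, x < w -> exists y, y < z /\
       R (scons y (scons x e))) by apply (B (e i) (le_refl _)).
    apply (Def1_ind (P := fun w => w <= e i -> exists z, forall x, x < w -> exists y, y < z /\
       R (scons y (scons x e)))).
    + apply Def1_ext with (P := fun e' => e i < e' O \/ exists z, forall x, x < e' O -> exists y,
         y < z /\ R (scons y (scons x e))).
      { intro e'. rewrite <- not_le. tauto. }
      apply Def1_or; [apply Def1_Def0, Def0_lt; [apply term_def_const|apply term_def_var]|].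
      apply Def1_ex, Def1_Def0.
      apply Def0_ball; [apply term_def_var|]. apply Def0_bex; [apply term_def_var|].
      apply (Def0_comp (f := fun e' => scons (e' O) (scons (e' 1%nat) e)) HR).
      intros [|[|j]]; [apply term_def_var|apply term_def_var|apply (term_def_const (e j))].
    + intros _. exists 0. intros x Hx. destruct (nlt_0 Hx).
    + intros w IH Hw. apply succ_le in Hw. destruct (IH (lt_le Hw)) as [z Hz].
      destruct (proj1 (HQ e w) (K w Hw)) as [y Hy].
      exists (z + y + 1). intros x Hx. apply lt_succ in Hx. destruct Hx as [Hx| ->].
      * destruct (Hz x Hx) as [y' [Hy' HR']]. exists y'. split; trivial.
        apply lt_trans with z; trivial. apply lt_succ, le_add_r.
      * exists y. split; trivial. apply lt_succ, le_add_l.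
  - intros [z Hz] x Hx. destruct (Hz x Hx) as [y [_ Hy]]. apply HQ. now exists y.
Qed.

(** The [Delta^0_1] predicates are closed under all connectives and bounded
    quantifiers, and under substitution of functions with a [Sigma^0_1] graph.
    They are therefore easier to handle than bounded formulas. *)
Definition Rec (P : env M -> Prop) : Prop := Def1 P /\ Def1 (fun e => ~ P e).

Definition RecT (t : env M -> M) : Prop := Def1 (fun e => e O = t (tail e)).

Lemma Rec_Def0 P : Def0 P -> Rec P.
Proof. intro H. split; apply Def1_Def0; trivial. now apply Def0_not. Qed.

Lemma Rec_ext (P Q : env M -> Prop) : (forall e, P e <-> Q e) -> Rec P -> Rec Q.
Proof.
  intros H [K L]. split; [revert K|revert L]; apply Def1_ext; trivial.
  intro e. now rewrite H.
Qed.
Lemma Rec_not P : Rec P -> Rec (fun e => ~ P e).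
Proof.
  intros [H K]. split; trivial. revert H. apply Def1_ext. intro e.
  split; [tauto|apply NNPP].
Qed.
Lemma Rec_and P Q : Rec P -> Rec Q -> Rec (fun e => P e /\ Q e).
Proof.
  intros [H K] [H' K']. split; [now apply Def1_and|].
  apply Def1_ext with (P := fun e => ~ P e \/ ~ Q e); [intro; tauto|now apply Def1_or].
Qed.
Lemma Rec_or P Q : Rec P -> Rec Q -> Rec (fun e => P e \/ Q e).
Proof.
  intros [H K] [H' K']. split; [now apply Def1_or|].
  apply Def1_ext with (P := fun e => ~ P e /\ ~ Q e); [intro; tauto|now apply Def1_and].
Qed.
Lemma Rec_imp P Q : Rec P -> Rec Q -> Rec (fun e => P e -> Q e).
Proof.
  intros H K. apply Rec_ext with (P := fun e => ~ P e \/ Q e); [intro; tauto|].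
  apply Rec_or; trivial. now apply Rec_not.
Qed.
Lemma Rec_iff P Q : Rec P -> Rec Q -> Rec (fun e => P e <-> Q e).
Proof. intros H K. apply Rec_and; now apply Rec_imp. Qed.

(** That [Q] holds of the value of [t] can be said existentially and
    universally, which is why both halves of [Rec] are preserved. *)
Lemma Rec_subst (t : env M -> M) (Q : env M -> M -> Prop) :
  RecT t -> Rec (fun e => Q (tail e) (e O)) -> Rec (fun e => Q e (t e)).
Proof.
  intros Ht [H K]. split.
  - apply Def1_ext with (P := fun e => exists x, x = t e /\ Q e x).
    + intro e. split; [now intros [x [-> L]]|intro L; now exists (t e)].
    + apply Def1_ex, Def1_and; trivial.
  - apply Def1_ext with (P := fun e => exists x, x = t e /\ ~ Q e x).
    + intro e. split; [now intros [x [-> L]]|intro L; now exists (t e)].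
    + apply Def1_ex, Def1_and; trivial.
Qed.

Lemma RecT_term_def t : term_def t -> RecT t.
Proof.
  intro H. apply Def1_Def0, Def0_eq; [apply term_def_var|exact (term_def_tail H)].
Qed.

Lemma Rec_comp (P : env M -> Prop) (f : env M -> env M) :
  Rec P -> (forall i, term_def (fun e => f e i)) -> Rec (fun e => P (f e)).
Proof.
  intros [H K] Hf. split; [exact (Def1_comp H Hf)|exact (Def1_comp K Hf)].
Qed.

Lemma RecT_comp (t : env M -> M) (f : env M -> env M) :
  RecT t -> (forall i, term_def (fun e => f e i)) -> RecT (fun e => t (f e)).
Proof.
  intros H Hf. apply (Def1_comp (f := fun e => scons (e O) (f (tail e))) H).
  intros [|i]; [apply term_def_var|exact (term_def_tail (Hf i))].
Qed.

Lemma RecT_tail t : RecT t -> RecT (fun e => t (tail e)).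
Proof. intro H. apply (RecT_comp (f := tail) H). intro i. apply term_def_var. Qed.

Lemma RecT_subst (t : env M -> M) (u : env M -> M -> M) :
  RecT t -> RecT (fun e => u (tail e) (e O)) -> RecT (fun e => u e (t e)).
Proof.
  intros Ht Hu. unfold RecT.
  apply Def1_ext with (P := fun e => exists x, x = t (tail e) /\ e O = u (tail e) x).
  - intro e. split; [now intros [x [-> L]]|intro L; now exists (t (tail e))].
  - apply Def1_ex, Def1_and.
    + exact (Def1_comp (f := fun e => scons (e O) (tail (tail e))) Ht
        ltac:(intros [|i]; apply term_def_var)).
    + apply (Def1_comp (f := fun e => scons (e 1%nat) (scons (e O) (tail (tail e)))) Hu).
      intros [|[|i]]; apply term_def_var.
Qed.

Lemma Rec_ball (t : env M -> M) (Q : env M -> M -> Prop) :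
  RecT t -> Rec (fun e => Q (tail e) (e O)) ->
  Rec (fun e => forall x, x < t e -> Q e x).
Proof.
  intros Ht [H K].
  apply (Rec_subst (Q := fun e y => forall x, x < y -> Q e x) Ht). split.
  - apply (Def1_ball (Q := fun e => Q (tail e)) O).
    apply (Def1_comp (f := fun e => scons (e O) (tail (tail e))) H).
    intros [|i]; apply term_def_var.
  - apply Def1_ext with (P := fun e => exists x, x < e O /\ ~ Q (tail e) x).
    + intro e. split.
      * intros [x [Hx N]] L. exact (N (L x Hx)).
      * intro N. apply NNPP. intro L. apply N. intros x Hx. apply NNPP.
        intro Hn. apply L. now exists x.
    + apply Def1_ex, Def1_and.
      * apply Def1_Def0, Def0_lt; apply term_def_var.
      * apply (Def1_comp (f := fun e => scons (e O) (tail (tail e))) K).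
        intros [|i]; apply term_def_var.
Qed.

Lemma Rec_bex (t : env M -> M) (Q : env M -> M -> Prop) :
  RecT t -> Rec (fun e => Q (tail e) (e O)) ->
  Rec (fun e => exists x, x < t e /\ Q e x).
Proof.
  intros Ht HQ.
  eapply Rec_ext;
    [|apply Rec_not, (Rec_ball (t := t) (Q := fun e x => ~ Q e x)); [exact Ht|apply Rec_not, HQ]].
  intro e. simpl. split.
  - intro H. apply NNPP. intro N. apply H. intros x Hx K. apply N. now exists x.
  - intros [x [Hx K]] H. exact (H x Hx K).
Qed.

Definition Rec1 (R : M -> Prop) : Prop := Rec (fun e => R (e O)).
Definition Rec2 (R : M -> M -> Prop) : Prop := Rec (fun e => R (e O) (e 1%nat)).
Definition Rec3 (R : M -> M -> M -> Prop) : Prop :=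
  Rec (fun e => R (e O) (e 1%nat) (e 2%nat)).
Definition RecF1 (f : M -> M) : Prop := RecT (fun e => f (e O)).
Definition RecF2 (f : M -> M -> M) : Prop := RecT (fun e => f (e O) (e 1%nat)).

Lemma Rec1_app R t : Rec1 R -> RecT t -> Rec (fun e => R (t e)).
Proof.
  intros HR Ht. apply (Rec_subst (Q := fun e x => R x) Ht). exact HR.
Qed.
Lemma Rec2_app R t u : Rec2 R -> RecT t -> RecT u -> Rec (fun e => R (t e) (u e)).
Proof.
  intros HR Ht Hu. apply (Rec_subst (Q := fun e x => R x (u e)) Ht).
  apply (Rec_subst (Q := fun e x => R (e O) x)); [now apply RecT_tail|].
  apply (Rec_comp (f := fun e => scons (e 1%nat) (scons (e O) e)) HR).
  intros [|[|i]]; apply term_def_var.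
Qed.
Lemma Rec3_app R t u v : Rec3 R -> RecT t -> RecT u -> RecT v ->
  Rec (fun e => R (t e) (u e) (v e)).
Proof.
  intros HR Ht Hu Hv. apply (Rec_subst (Q := fun e x => R x (u e) (v e)) Ht).
  apply (Rec_subst (Q := fun e x => R (e O) x (v (tail e)))); [now apply RecT_tail|].
  apply (Rec_subst (Q := fun e x => R (e 1%nat) (e O) x)); [exact (RecT_tail (RecT_tail Hv))|].
  apply (Rec_comp (f := fun e => scons (e 2%nat) (scons (e 1%nat) (scons (e O) e))) HR).
  intros [|[|[|i]]]; apply term_def_var.
Qed.
Lemma RecF1_app f t : RecF1 f -> RecT t -> RecT (fun e => f (t e)).
Proof.
  intros Hf Ht. apply (RecT_subst (u := fun e x => f x) Ht). exact Hf.
Qed.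
Lemma RecF2_app f t u : RecF2 f -> RecT t -> RecT u -> RecT (fun e => f (t e) (u e)).
Proof.
  intros Hf Ht Hu. apply (RecT_subst (u := fun e x => f x (u e)) Ht).
  apply (RecT_subst (u := fun e x => f (e O) x)); [now apply RecT_tail|].
  apply (RecT_comp (f := fun e => scons (e 1%nat) (scons (e O) e)) Hf).
  intros [|[|i]]; apply term_def_var.
Qed.

Lemma Rec2_eq : Rec2 (fun x y => x = y).
Proof. apply Rec_Def0, Def0_eq; apply term_def_var. Qed.
Lemma Rec2_lt : Rec2 (mlt M).
Proof. apply Rec_Def0, Def0_lt; apply term_def_var. Qed.
Lemma Rec2_le : Rec2 (@mle M).
Proof. apply Rec_Def0, Def0_or; [apply Def0_lt|apply Def0_eq]; apply term_def_var. Qed.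
Lemma Rec1_mem X : Rec1 (fun x => x ∈ X).
Proof. apply Rec_Def0, Def0_mem, term_def_var. Qed.
Lemma RecF2_plus : RecF2 (mplus M).
Proof. apply RecT_term_def, term_def_plus; apply term_def_var. Qed.
Lemma RecF2_mult : RecF2 (mmult M).
Proof. apply RecT_term_def, term_def_mult; apply term_def_var. Qed.
Lemma RecF2_pair : RecF2 pair.
Proof.
  apply RecT_term_def.
  repeat first [apply term_def_plus|apply term_def_mult|apply term_def_var].
Qed.
Lemma Rec_const (P : Prop) : Rec (fun _ => P).
Proof.
  destruct (classic P) as [H|H]; apply Rec_Def0.
  - apply Def0_ext with (P := fun _ => ~ False); [tauto|apply Def0_not, Def0_bot].
  - apply Def0_ext with (P := fun _ => False); [tauto|apply Def0_bot].
Qed.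

End Model.

Create HintDb rec.
#[export] Hint Resolve Rec2_lt Rec2_le Rec2_eq RecF2_plus RecF2_mult RecF2_pair : rec.

Ltac rec_fact := solve [assumption | auto with rec nocore].

(** Only the shape of the predicate is followed: bounded quantifiers have to be
    written with a strict bound, and the facts about defined predicates and
    functions come from the hint database and the context. A goal [Def1] may
    begin with unbounded existential quantifiers. *)
Ltac rec_step :=
  cbv beta delta [tail];
  lazymatch goal with
  | |- RecT (fun e => e ?i) => exact (RecT_term_def (term_def_var i))
  | |- RecT (fun _ => ?c) => exact (RecT_term_def (term_def_const c))
  | |- RecT _ => match goal with
    | |- RecT (fun e => ?f (@?a e) (@?b e)) =>
        refine (RecF2_app (f := f) (t := a) (u := b) _ _ _); [rec_fact| |]
    | |- RecT (fun e => ?f (@?a e)) =>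
        refine (RecF1_app (f := f) (t := a) _ _); [rec_fact|]
    end
  | |- Rec (fun _ => ?c) => exact (Rec_const c)
  | |- Rec (fun e => @?A e /\ @?B e) => refine (Rec_and (P := A) (Q := B) _ _)
  | |- Rec (fun e => @?A e \/ @?B e) => refine (Rec_or (P := A) (Q := B) _ _)
  | |- Rec (fun e => @?A e <-> @?B e) => refine (Rec_iff (P := A) (Q := B) _ _)
  | |- Rec (fun e => ~ @?A e) => refine (Rec_not (P := A) _)
  | |- Rec (fun e => forall x, x < @?t e -> @?Q e x) =>
      refine (Rec_ball (t := t) (Q := Q) _ _)
  | |- Rec (fun e => exists x, x < @?t e /\ @?Q e x) =>
      refine (Rec_bex (t := t) (Q := Q) _ _)
  | |- Rec (fun e => @?A e -> @?B e) => refine (Rec_imp (P := A) (Q := B) _ _)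
  | |- Rec (fun e => @?a e ∈ ?X) => refine (Rec1_app (t := a) (Rec1_mem X) _)
  | |- Rec (fun e => @?a e = @?b e) =>
      refine (Rec2_app (t := a) (u := b) Rec2_eq _ _)
  | |- Rec _ => match goal with
    | |- Rec (fun e => ?R (@?a e) (@?b e) (@?c e)) =>
        refine (Rec3_app (R := R) (t := a) (u := b) (v := c) _ _ _ _); [rec_fact| | |]
    | |- Rec (fun e => ?R (@?a e) (@?b e)) =>
        refine (Rec2_app (R := R) (t := a) (u := b) _ _ _); [rec_fact| |]
    | |- Rec (fun e => ?R (@?a e)) =>
        refine (Rec1_app (R := R) (t := a) _ _); [rec_fact|]
    end
  | |- Def1 (fun e => exists x, @?Q e x) => refine (Def1_ex (Q := Q) _)
  | |- Def1 (fun e => @?A e /\ @?B e) => refine (Def1_and (P := A) (Q := B) _ _)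
  | |- Def1 (fun e => @?A e \/ @?B e) => refine (Def1_or (P := A) (Q := B) _ _)
  | |- Def1 ?P => refine (proj1 (_ : Rec P))
  end.

Ltac rec := try unfold RecF1, RecF2, Rec1, Rec2, Rec3; repeat rec_step.

Section Coding.

Context {M : model} {HM : rca0 M}.

Add Ring M_ring2 : (@M_semiring M HM).

(** * Induction, minimization and bounding *)

Lemma Rec_ind (P : M -> Prop) :
  Rec1 P -> P 0 -> (forall x, P x -> P (x + 1)) -> forall x, P x.
Proof. intros [H _]. exact (Def1_ind H). Qed.

Lemma least (P : M -> Prop) :
  Rec1 P -> (exists x, P x) -> exists x, P x /\ forall y, y < x -> ~ P y.
Proof.
  intros R [x Px]. apply NNPP. intro N.
  enough (H : forall x y, y < x -> ~ P y) by exact (H _ _ (lt_S x) Px).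
  clear x Px. apply (Rec_ind (P := fun x => forall y, y < x -> ~ P y)).
  - rec.
  - intros y Hy. destruct (nlt_0 Hy).
  - intros x IH y Hy Py. apply lt_succ in Hy. destruct Hy as [Hy| ->].
    + exact (IH y Hy Py).
    + apply N. exists x. now split.
Qed.

(** The greatest element is the least number above which, up to [b], nothing
    satisfies [P]. *)
Lemma greatest (P : M -> Prop) b :
  Rec1 P -> (exists x, x <= b /\ P x) ->
  exists x, x <= b /\ P x /\ forall y, x < y -> y <= b -> ~ P y.
Proof.
  intros R [x0 [Hx0 Px0]].
  destruct (least (P := fun z => z <= b /\ forall y, y < b + 1 -> z < y -> ~ P y))
    as [z [[Hz Hl] Hmin]]; [rec| |].
  { exists b. split; [apply le_refl|]. intros y Hy Hb. apply lt_succ in Hy.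
    destruct (lt_not_le Hb Hy). }
  exists z. split; trivial. split.
  - apply NNPP. intro N. destruct (zero_or_succ z) as [->|[w ->]].
    + apply (Hl x0); trivial; [now apply lt_succ|].
      destruct (le_0 x0) as [K|<-]; [trivial|contradiction].
    + apply (Hmin w (lt_S w)). split; [exact (le_trans (lt_le (lt_S w)) Hz)|].
      intros y Hy Hw. apply succ_le in Hw. destruct Hw as [Hw| <-]; trivial. now apply Hl.
  - intros y Hy Hb. apply Hl; trivial. now apply lt_succ.
Qed.

Lemma RecF1_graph (f : M -> M) : Rec2 (fun x y => y = f x) -> RecF1 f.
Proof.
  intro H. apply (proj1 (Rec_comp (f := fun e => scons (e 1%nat) (scons (e O) e)) H
     ltac:(intros [|[|i]]; apply term_def_var))).
Qed.

(** A total recursive relation contains a recursive function, the one that picks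
    the least value. *)
Lemma Rec_choice (R : M -> M -> Prop) :
  Rec2 R -> (forall x, exists y, R x y) ->
  exists f, RecF1 f /\ forall x, R x (f x).
Proof.
  intros HR H.
  assert (L : forall x, exists y, R x y /\ forall z, z < y -> ~ R x z).
  { intro x. apply (least (P := R x)); [rec|apply H]. }
  destruct (choice _ L) as [f Hf]. exists f. split; [|intro x; apply Hf].
  apply RecF1_graph.
  apply (Rec_ext (P := fun e => R (e O) (e 1%nat) /\ forall z, z < e 1%nat -> ~ R (e O) z));
    [|rec].
  intro e. destruct (Hf (e O)) as [K K']. split.
  - intros [Q Q']. destruct (lt_total (e 1%nat) (f (e O))) as [C|[C|C]]; trivial.
    + destruct (K' _ C Q).
    + destruct (Q' _ C K).
  - intros ->. now split.
Qed.

Lemma bounding (R : M -> M -> Prop) b :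
  Rec2 R -> (forall x, x < b -> exists y, R x y) ->
  exists z, forall x, x < b -> exists y, y < z /\ R x y.
Proof.
  intros HR H.
  enough (K : forall w, w <= b -> exists z, forall x, x < w -> exists y, y < z /\ R x y)
    by exact (K b (le_refl b)).
  apply (Def1_ind (P := fun w => w <= b ->
    exists z, forall x, x < w -> exists y, y < z /\ R x y)).
  - apply (Def1_ext (P := fun e => ~ e O <= b \/
      exists z, forall x, x < e O -> exists y, y < z /\ R x y)).
    { intro e. tauto. }
    rec.
  - intros _. exists 0. intros x Hx. destruct (nlt_0 Hx).
  - intros w IH Hw. apply succ_le in Hw. destruct (IH (lt_le Hw)) as [z Hz].
    destruct (H w Hw) as [y Hy]. exists (z + y + 1). intros x Hx.
    apply lt_succ in Hx. destruct Hx as [Hx| ->].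
    + destruct (Hz x Hx) as [y' [Hy' K]]. exists y'. split; trivial.
      apply lt_trans with z; trivial. apply lt_succ, le_add_r.
    + exists y. split; trivial. apply lt_succ, le_add_l.
Qed.

Lemma bounded_values (f : M -> M) b :
  RecF1 f -> exists z, forall x, x < b -> f x < z.
Proof.
  intro Hf. destruct (@bounding (fun x y => y = f x) b) as [z Hz].
  - rec.
  - intros x _. now exists (f x).
  - exists z. intros x Hx. destruct (Hz x Hx) as [y [Hy ->]]. exact Hy.
Qed.

Lemma comprehension (P : M -> Prop) : Rec1 P -> exists X, forall x, x ∈ X <-> P x.
Proof. intros [H K]. exact (Delta1_comprehension H K). Qed.

(** * Divisibility *)

Definition Divides (d n : M) : Prop := exists q, n = d * q.

Lemma Divides_mul_r d n a : Divides d n -> Divides d (n * a).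
Proof. intros [q ->]. exists (q * a). ring. Qed.
Lemma Divides_mul_l d n a : Divides d n -> Divides d (a * n).
Proof. intros [q ->]. exists (q * a). ring. Qed.
Lemma Divides_self d : Divides d d.
Proof. exists 1. ring. Qed.
Lemma Divides_trans a b c : Divides a b -> Divides b c -> Divides a c.
Proof. intros [q ->] [r ->]. exists (q * r). ring. Qed.
Lemma Divides_le (d n : M) : Divides d n -> 0 < n -> d <= n.
Proof.
  intros [q ->] H. destruct (zero_or_succ q) as [->|[r ->]].
  - rewrite mul0 in H. destruct (lt_irrefl H).
  - apply le_exists. exists (d * r). ring.
Qed.

Lemma Divides_sub d a b : Divides d (a + b) -> Divides d a -> Divides d b.
Proof.
  intros [q H] [r ->]. destruct (le_or_lt r q) as [K|K].
  - apply le_exists in K. destruct K as [s ->]. exists s.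
    apply (add_cancel (z := d * r)). rewrite addC, H. ring.
  - apply lt_exists in K. destruct K as [s ->]. exists 0. rewrite mul0.
    apply le_antisym; [|apply le_0].
    apply le_exists. exists (d * (s + 1)). symmetry.
    apply (add_cancel (z := d * q)). rewrite <- H at 2. ring_simplify.
    rewrite <- H. ring.
Qed.

Lemma Rec2_Divides : Rec2 Divides.
Proof.
  apply (Rec_ext (P := fun e => exists q, q < e 1%nat + 1 /\ e 1%nat = e O * q)); [|rec].
  intro e. split.
  - intros [q [_ H]]. now exists q.
  - intros [q H]. destruct (le_0 (e 1%nat)) as [K|K].
    + exists q. split; trivial. apply lt_succ, Divides_le; trivial. exists (e O).
      rewrite H. ring.
    + exists 0. split; [apply lt_0_succ|]. rewrite mul0. now rewrite <- K.
Qed.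
Hint Resolve Rec2_Divides : rec.

Lemma division (n d : M) : 0 < d -> exists q r, n = d * q + r /\ r < d.
Proof.
  intro Hd. revert n.
  apply (Def1_ind (P := fun n => exists q r, n = d * q + r /\ r < d)).
  - rec.
  - exists 0, 0. split; trivial. ring.
  - intros n [q [r [-> Hr]]]. apply succ_le in Hr. destruct Hr as [Hr|Hr].
    + exists q, (r + 1). split; trivial. ring.
    + exists (q + 1), 0. split; trivial. rewrite <- Hr. ring.
Qed.

Lemma common_multiple (k : M) : exists m, 0 < m /\ forall e, e < k + 1 -> 0 < e -> Divides e m.
Proof.
  revert k.
  apply (Def1_ind (P := fun k => exists m, 0 < m /\
    forall e, e < k + 1 -> 0 < e -> Divides e m)).
  - rec.
  - exists 1. split; [apply lt01|]. intros e He K. replace (0 + 1) with (mone M) in He by ring.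
    apply discrete in K. destruct (lt_not_le He K).
  - intros k [m [Hm H]]. exists (m * (k + 1)). split; [apply mul_pos; trivial; apply lt_0_succ|].
    intros e He K. apply lt_succ in He. destruct He as [He| ->].
    + apply Divides_mul_r, H; trivial.
    + apply Divides_mul_l, Divides_self.
Qed.

(** The divisor that stands for [x] in the code of a finite set; Goedel's beta
    function uses the same moduli. *)
Definition modulus (m x : M) : M := m * (x + 1) + 1.

Lemma RecF2_modulus : RecF2 modulus.
Proof. unfold modulus. rec. Qed.
Hint Resolve RecF2_modulus : rec.

Lemma modulus_gt1 (m x : M) : 0 < m -> 1 < modulus m x.
Proof.
  intro H. unfold modulus. apply lt_exists in H. destruct H as [z ->].
  apply lt_exists. exists (z * x + z + x). ring.
Qed.

Lemma modulus_not_Divides1 (m x : M) : 0 < m -> ~ Divides (modulus m x) 1.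
Proof.
  intros Hm H. apply Divides_le in H; [|apply lt01].
  exact (lt_not_le (modulus_gt1 x Hm) H).
Qed.

(** As [m] is a multiple of the difference of [x] and [j], their moduli are
    coprime. This case of Euclid's lemma needs no Bezout coefficients: a modulus
    that divides [m * a] also divides [a], and this cancels first the factor
    [m] of the difference of the two moduli, then the difference [e] of [x] and
    [j] itself, once [e] is completed to [m]. *)
Lemma modulus_coprime (m k x j n : M) :
  (forall e, e < k + 1 -> 0 < e -> Divides e m) -> x < k -> j < k -> x <> j ->
  Divides (modulus m x) (n * modulus m j) -> Divides (modulus m x) n.
Proof.
  intros Hm Hx Hj Hne H. set (d := modulus m x) in *.
  assert (A : forall a, Divides d (m * a) -> Divides d a).
  { intros a Ha. apply (Divides_sub (a := m * a * (x + 1))).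
    - exists a. unfold d, modulus. ring.
    - now apply Divides_mul_r. }
  (* The moduli of x and j differ by m * e, where e is the distance of x and j. *)
  assert (B : exists e, 0 < e /\ e < k + 1 /\ Divides d (m * (e * n))).
  { destruct (lt_total x j) as [K|[K|K]]; [|contradiction|].
    - apply lt_exists in K. destruct K as [f ->]. exists (f + 1).
      split; [apply lt_0_succ|]. split.
      { apply lt_le_trans with (x + f + 1 + 1); [|].
        - apply lt_exists. exists x. ring.
        - apply le_add; [now left|apply le_refl]. }
      apply (Divides_sub (a := n * d)); [|apply Divides_mul_l, Divides_self].
      replace (n * d + m * ((f + 1) * n)) with (n * modulus m (x + f + 1)); trivial.
      unfold d, modulus. ring.
    - apply lt_exists in K. destruct K as [f ->]. exists (f + 1).
      split; [apply lt_0_succ|]. split.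
      { apply lt_le_trans with (j + f + 1 + 1); [|].
        - apply lt_exists. exists j. ring.
        - apply le_add; [now left|apply le_refl]. }
      apply (Divides_sub (a := n * modulus m j)); trivial.
      replace (n * modulus m j + m * ((f + 1) * n)) with (n * d);
        [apply Divides_mul_l, Divides_self|].
      unfold d, modulus. ring. }
  destruct B as [e [He [Hek B]]]. apply A in B. apply A.
  destruct (Hm e Hek He) as [r ->].
  replace (e * r * n) with (e * n * r) by ring. now apply Divides_mul_r.
Qed.

(** The product of the moduli of the elements of [P], built by induction: by
    coprimality no further modulus divides it. The factor [m] is fixed
    beforehand, so that codes of different sets can be compared. *)
Lemma exact_code (m k : M) (P : M -> Prop) :
  0 < m -> (forall e, e < k + 1 -> 0 < e -> Divides e m) -> Rec1 P ->
  exists n, 0 < n /\ forall x, x < k -> (Divides (modulus m x) n <-> P x).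
Proof.
  intros Hm0 Hm HP.
  assert (H : forall j, exists n, 0 < n /\
    forall x, x < k -> (Divides (modulus m x) n <-> x < j /\ P x)).
  { apply (Def1_ind (P := fun j => exists n, 0 < n /\
      forall x, x < k -> (Divides (modulus m x) n <-> x < j /\ P x))).
    - rec.
    - exists 1. split; [apply lt01|]. intros x _. split.
      + intro H. destruct (modulus_not_Divides1 Hm0 H).
      + intros [H _]. destruct (nlt_0 H).
    - intros j [n [Hn H]].
      destruct (classic (j < k /\ P j)) as [[Hj Pj]|N].
      + exists (n * modulus m j). split.
        { apply mul_pos; trivial. apply lt_trans with 1; [apply lt01|now apply modulus_gt1]. }
        intros x Hx. rewrite lt_succ. destruct (classic (x = j)) as [->|Hne].
        * split; [intros _; split; [apply le_refl|exact Pj]|].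
          intros _. apply Divides_mul_l, Divides_self.
        * split.
          -- intro D. apply (modulus_coprime Hm Hx Hj Hne) in D. apply (H x Hx) in D.
             destruct D as [D D']. split; [now left|trivial].
          -- intros [[D|D] D']; [|contradiction]. apply Divides_mul_r, H; tauto.
      + exists n. split; trivial. intros x Hx. rewrite (H x Hx), lt_succ.
        split; intros [D D']; (split; [|trivial]); [now left|].
        destruct D as [D| ->]; trivial. tauto. }
  destruct (H k) as [n [Hn K]]. exists n. split; trivial. intros x Hx.
  rewrite (K x Hx). tauto.
Qed.

(** * Codes of finite sets *)

Definition triple (k m n : M) : M := pair k (pair m n).

Definition isTriple (c : M) : Prop := exists k m n, c = triple k m n.

Definition code_mem (x c : M) : Prop :=
  exists k m n, c = triple k m n /\ x < k /\ Divides (modulus m x) n.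

Definition canonical_code (c : M) : Prop :=
  isTriple c /\ forall d, d < c -> isTriple d -> ~ forall x, code_mem x c <-> code_mem x d.

Lemma triple_le (k m n c : M) : c = triple k m n -> k < c + 1 /\ m < c + 1 /\ n < c + 1.
Proof.
  intros ->. unfold triple. rewrite !lt_succ. split; [apply pair_le_l|].
  split; eapply le_trans; [apply pair_le_l|apply pair_le_r|apply pair_le_r|apply pair_le_r].
Qed.

(** This bounds all quantifiers over elements of coded sets. *)
Lemma code_mem_lt (x c : M) : code_mem x c -> x < c.
Proof.
  intros [k [m [n [H [K _]]]]]. apply triple_le in H. destruct H as [H _].
  apply lt_succ in H. exact (lt_le_trans K H).
Qed.

Lemma Rec1_isTriple : Rec1 isTriple.
Proof.
  apply (Rec_ext (P := fun e => exists k, k < e O + 1 /\ exists m, m < e O + 1 /\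
    exists n, n < e O + 1 /\ e O = pair k (pair m n))); [|rec].
  intro e. split.
  - intros [k [_ [m [_ [n [_ H]]]]]]. now exists k, m, n.
  - intros [k [m [n H]]]. destruct (triple_le H) as [Hk [Hm Hn]].
    exists k; split; trivial. exists m; split; trivial. now exists n.
Qed.

Lemma Rec2_code_mem : Rec2 code_mem.
Proof.
  apply (Rec_ext (P := fun e => exists k, k < e 1%nat + 1 /\ exists m, m < e 1%nat + 1 /\
    exists n, n < e 1%nat + 1 /\ (e 1%nat = pair k (pair m n) /\ e O < k /\
      Divides (modulus m (e O)) n))); [|rec].
  intro e. split.
  - intros [k [_ [m [_ [n [_ H]]]]]]. now exists k, m, n.
  - intros [k [m [n H]]]. destruct (triple_le (proj1 H)) as [Hk [Hm Hn]].
    exists k; split; trivial. exists m; split; trivial. now exists n.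
Qed.
Hint Resolve Rec1_isTriple Rec2_code_mem : rec.

Lemma Rec1_canonical_code : Rec1 canonical_code.
Proof.
  apply (Rec_ext (P := fun e => isTriple (e O) /\ forall d, d < e O -> isTriple d ->
    ~ forall x, x < e O -> (code_mem x (e O) <-> code_mem x d))); [|rec].
  intro e. unfold canonical_code. split.
  - intros [H K]. split; trivial. intros d Hd T L. apply (K d Hd T). intros x _. apply L.
  - intros [H K]. split; trivial. intros d Hd T L. apply (K d Hd T). intro x.
    destruct (le_or_lt (e O) x) as [G|G]; [|now apply L].
    split; intro F; apply code_mem_lt in F.
    + destruct (lt_not_le F G).
    + destruct (lt_not_le (lt_trans F Hd) G).
Qed.
Hint Resolve Rec1_canonical_code : rec.

(** [exact_code] gives some triple that represents the set, and the least such
    triple is its canonical code. *)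
Lemma finite_set (P : M -> Prop) k :
  Rec1 P -> (forall x, P x -> x < k) ->
  exists c, canonical_code c /\ forall x, code_mem x c <-> P x.
Proof.
  intros HP Hk.
  destruct (least (P := fun c => isTriple c /\ (forall x, x < c -> code_mem x c -> P x) /\
    (forall x, x < k -> P x -> code_mem x c))) as [c [[T [H H']] K]].
  - rec.
  - destruct (common_multiple k) as [m [Hm0 Hm]].
    destruct (exact_code Hm0 Hm HP) as [n [_ Hn]].
    exists (triple k m n). split; [now exists k, m, n|]. split.
    + intros x _ [k' [m' [n' [E [Hx D]]]]]. apply pair_inj in E. destruct E as [<- E].
      apply pair_inj in E. destruct E as [<- <-]. now apply Hn.
    + intros x Hx Px. exists k, m, n. repeat split; trivial. now apply Hn.
  - assert (E : forall x, code_mem x c <-> P x).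
    { intro x. split; intro Hx; [apply H; trivial; now apply code_mem_lt|].
      apply H'; trivial. now apply Hk. }
    exists c. split; trivial. split; trivial. intros d Hd Td N. apply (K d Hd).
    split; trivial. split; intros x _ Hx.
    + apply E, N, Hx.
    + apply N, E, Hx.
Qed.

Lemma canonical_code_ext c d :
  canonical_code c -> canonical_code d ->
  (forall x, code_mem x c <-> code_mem x d) -> c = d.
Proof.
  intros [Tc Hc] [Td Hd] E. destruct (lt_total c d) as [K|[K|K]]; trivial; exfalso.
  - apply (Hd c K Tc). intro x. symmetry. apply E.
  - apply (Hc d K Td). exact E.
Qed.

(** * Strong bounding *)

(** The least positive common multiple of the moduli of the values before [u]
    grows with each new value, by coprimality, and is bounded by a common
    multiple of the moduli of all numbers below [b]; so new values cannot appear
    for ever. That it is at least [y] for some [u] is a [Sigma^0_1] statement,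
    which is proved by induction on [y]. *)
Theorem values_exhausted (g : M -> M) b :
  RecF1 g -> (forall x, g x < b) ->
  exists u, forall j, exists i, i < u /\ g i = g j.
Proof.
  intros Hg Hb. apply NNPP. intro N.
  destruct (common_multiple b) as [m [Hm0 Hm]].
  assert (H : forall y, exists u, forall z, z < y -> 0 < z ->
    exists i, i < u /\ ~ Divides (modulus m (g i)) z).
  { apply (Def1_ind (P := fun y => exists u, forall z, z < y -> 0 < z ->
      exists i, i < u /\ ~ Divides (modulus m (g i)) z)).
    - rec.
    - exists 0. intros z Hz. destruct (nlt_0 Hz).
    - intros y [u Hu].
      assert (J : exists j, forall i, i < u -> g i <> g j).
      { apply NNPP. intro L. apply N. exists u. intro j. apply NNPP. intro L'.
        apply L. exists j. intros i Hi E. apply L'. now exists i. }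
      destruct J as [j Hj].
      exists (u + j + 1). intros z Hz Hz0. apply lt_succ in Hz.
      destruct Hz as [Hz| ->].
      { destruct (Hu z Hz Hz0) as [i [Hi D]]. exists i. split; trivial.
        apply lt_trans with u; trivial. apply lt_succ, le_add_r. }
      apply NNPP. intro L.
      assert (D : forall i, i < u + j + 1 -> Divides (modulus m (g i)) y).
      { intros i Hi. apply NNPP. intro D. apply L. now exists i. }
      assert (Du : forall i, i < u -> Divides (modulus m (g i)) y).
      { intros i Hi. apply D. apply lt_trans with u; trivial. apply lt_succ, le_add_r. }
      destruct (exact_code Hm0 Hm (P := fun w => exists i, i < u /\ g i = w))
        as [n [Hn K]]; [rec|].
      (* The least common multiple y divides every common multiple. *)
      assert (Y : Divides y n).
      { destruct (division n Hz0) as [q [r [-> Hr]]].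
        destruct (le_0 r) as [R| <-]; [|exists q; ring].
        destruct (Hu r Hr R) as [i [Hi Di]]. destruct Di.
        apply (Divides_sub (a := y * q)); [|now apply Divides_mul_r, Du].
        apply K; [apply Hb|]. now exists i. }
      assert (W : Divides (modulus m (g j)) n).
      { apply Divides_trans with y; trivial. apply D. apply lt_succ, le_add_l. }
      apply K in W; [|apply Hb]. destruct W as [i [Hi E]]. exact (Hj i Hi E). }
  destruct (exact_code Hm0 Hm (P := fun _ => True)) as [n [Hn K]]; [rec|].
  (* The product of all moduli is a common multiple below n + 1. *)
  destruct (H (n + 1)) as [u Hu]. destruct (Hu n (lt_S n) Hn) as [i [_ D]].
  apply D, K; trivial.
Qed.

End Coding.

#[export] Hint Resolve Rec2_Divides RecF2_modulus Rec1_isTriple Rec2_code_mem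
  Rec1_canonical_code : rec.

(** * Well-quasi-orders in a model *)

Section Translation.

Context {M : model}.

Definition QuasiOrder (Q R : nat) : Prop :=
  (forall z : M, z ∈ R -> exists x y, x ∈ Q /\ y ∈ Q /\ z = pair x y) /\
  (forall x : M, x ∈ Q -> pair x x ∈ R) /\
  (forall x y z : M, pair x y ∈ R /\ pair y z ∈ R -> pair x z ∈ R).

Definition SequenceIn (F Q : nat) : Prop :=
  (forall z : M, z ∈ F -> exists i x, x ∈ Q /\ z = pair i x) /\
  (forall i : M, exists x, pair i x ∈ F) /\
  (forall i x y : M, pair i x ∈ F /\ pair i y ∈ F -> x = y).

Definition WellQuasiOrder (Q R : nat) : Prop :=
  QuasiOrder Q R /\ forall F, SequenceIn F Q ->
    exists m n a b : M, m < n /\ pair m a ∈ F /\ pair n b ∈ F /\ pair a b ∈ R.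

Definition below (R : nat) (a b : M) : Prop :=
  forall x, code_mem x a -> exists y, code_mem y b /\ pair x y ∈ R.

Definition Pf_flat (Q R P S : nat) : Prop :=
  (forall c : M, c ∈ P <-> canonical_code c /\ forall x, code_mem x c -> x ∈ Q) /\
  (forall z : M, z ∈ S <->
     exists a b, z = pair a b /\ a ∈ P /\ b ∈ P /\ below R a b).

Lemma sat_and_cong e E phi psi P Q : (sat M e E phi <-> P) -> (sat M e E psi <-> Q) ->
  (sat M e E (phi ⋏ psi) <-> P /\ Q).
Proof. rewrite sat_And. tauto. Qed.
Lemma sat_iff_cong e E phi psi P Q : (sat M e E phi <-> P) -> (sat M e E psi <-> Q) ->
  (sat M e E (phi ⟷ psi) <-> (P <-> Q)).
Proof. rewrite sat_Iff. tauto. Qed.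
Lemma sat_neg_cong e E phi P : (sat M e E phi <-> P) -> (sat M e E (¬ phi) <-> ~ P).
Proof. simpl. tauto. Qed.
Lemma sat_imp_cong e E phi psi P Q : (sat M e E phi <-> P) -> (sat M e E psi <-> Q) ->
  (sat M e E (phi ⟶ psi) <-> (P -> Q)).
Proof. simpl. tauto. Qed.
Lemma sat_all1_cong e E phi P : (forall x, sat M (scons x e) E phi <-> P x) ->
  (sat M e E (∀¹ phi) <-> forall x, P x).
Proof. simpl. firstorder. Qed.
Lemma sat_all2_cong e E phi P : (forall X, sat M e (scons X E) phi <-> P X) ->
  (sat M e E (∀² phi) <-> forall X, P X).
Proof. simpl. firstorder. Qed.
Lemma sat_ex1_cong e E phi P : (forall x, sat M (scons x e) E phi <-> P x) ->
  (sat M e E (∃¹ phi) <-> exists x, P x).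
Proof. rewrite sat_ex1. firstorder. Qed.
Lemma sat_ex2_cong e E phi P : (forall X, sat M e (scons X E) phi <-> P X) ->
  (sat M e E (∃² phi) <-> exists X, P X).
Proof. rewrite sat_ex2. firstorder. Qed.

(** For goals [sat M e E phi <-> P]. Rewriting would see through the defined
    formulas, so the connectives of [phi] and [P] are matched syntactically;
    atomic formulas compute. *)
Ltac translate :=
  lazymatch goal with
  | |- sat _ _ _ (And _ _) <-> _ => apply sat_and_cong; translate
  | |- sat _ _ _ (Iff _ _) <-> _ => apply sat_iff_cong; translate
  | |- sat _ _ _ (Neg _) <-> _ => apply sat_neg_cong; translate
  | |- sat _ _ _ (imp _ _) <-> _ => apply sat_imp_cong; translate
  | |- sat _ _ _ (all1 _) <-> _ => apply sat_all1_cong; intro; translate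
  | |- sat _ _ _ (all2 _) <-> _ => apply sat_all2_cong; intro; translate
  | |- sat _ _ _ (ex1 _) <-> _ => apply sat_ex1_cong; intro; translate
  | |- sat _ _ _ (ex2 _) <-> _ => apply sat_ex2_cong; intro; translate
  | |- _ => try reflexivity
  end.

Lemma sat_quasi_order e E Q R :
  sat M e E (quasi_order Q R) <-> QuasiOrder (E Q) (E R).
Proof. unfold quasi_order, QuasiOrder. translate. Qed.

Lemma sat_sequence_in e E F Q :
  sat M e E (sequence_in F Q) <-> SequenceIn (E F) (E Q).
Proof. unfold sequence_in, SequenceIn. translate. Qed.

Lemma sat_wqo e E Q R : sat M e E (wqo Q R) <-> WellQuasiOrder (E Q) (E R).
Proof.
  unfold wqo, WellQuasiOrder. translate; [apply sat_quasi_order|].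
  exact (sat_sequence_in e (scons _ E) 0 (S Q)).
Qed.

Lemma sat_fin_mem e E x c :
  sat M e E (fin_mem x c) <-> code_mem (teval M e x) (teval M e c).
Proof.
  unfold fin_mem, code_mem, Divides.
  translate; cbn [sat teval]; unfold lift; now rewrite !teval_tsubst.
Qed.

Lemma sat_is_triple e E c : sat M e E (is_triple c) <-> isTriple (teval M e c).
Proof.
  unfold is_triple, isTriple.
  translate. cbn [teval sat]; unfold lift; now rewrite !teval_tsubst.
Qed.

Lemma sat_fin_code e E c :
  sat M e E (fin_code c) <-> canonical_code (teval M e c).
Proof.
  transitivity (isTriple (teval M e c) /\ forall d, d < teval M e c /\ isTriple d ->
    ~ forall x, code_mem x (teval M e c) <-> code_mem x d).
  - unfold fin_code. translate.
    + apply sat_is_triple.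
    + cbn [sat]. now rewrite teval_lift1.
    + exact (sat_is_triple (scons _ e) E #0).
    + rewrite sat_fin_mem. unfold lift. now rewrite teval_tsubst.
    + exact (sat_fin_mem (scons _ (scons _ e)) E #0 #1).
  - unfold canonical_code. split; intros [H K]; (split; [exact H|]); intros d; [|intros []]; auto.
Qed.

Lemma sat_is_Pf_flat e E Q R P S :
  sat M e E (is_Pf_flat Q R P S) <-> Pf_flat (E Q) (E R) (E P) (E S).
Proof.
  unfold is_Pf_flat, Pf_flat, below. translate.
  - exact (sat_fin_code (scons _ e) E #0).
  - exact (sat_fin_mem (scons _ (scons _ e)) E #0 #1).
  - exact (sat_fin_mem (scons _ (scons _ (scons _ (scons _ e)))) E #0 #2).
  - exact (sat_fin_mem (scons _ (scons _ (scons _ (scons _ (scons _ e))))) E #0 #2).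
Qed.

Lemma sat_Pf_flat_preserves_wqo e E :
  sat M e E Pf_flat_preserves_wqo <->
  forall Q R, QuasiOrder Q R -> WellQuasiOrder Q R ->
    exists P S, Pf_flat Q R P S /\ WellQuasiOrder P S.
Proof.
  unfold Pf_flat_preserves_wqo. translate.
  - exact (sat_quasi_order e (scons _ (scons _ E)) 1 0).
  - exact (sat_wqo e (scons _ (scons _ E)) 1 0).
  - exact (sat_is_Pf_flat e (scons _ (scons _ (scons _ (scons _ E)))) 3 2 1 0).
  - exact (sat_wqo e (scons _ (scons _ (scons _ (scons _ E)))) 1 0).
Qed.

End Translation.

(** * From finite powersets to arithmetical comprehension *)

Section Reversal.

Context {M : model} {HM : rca0 M}.

Add Ring M_ring3 : (@M_semiring M HM).

Lemma pair_lt_succ (x y : M) : x < pair x y + 1 /\ y < pair x y + 1.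
Proof. rewrite !lt_succ. split; [apply pair_le_l|apply pair_le_r]. Qed.

Section TrueStages.

Variable h : M -> M.
Hypothesis Rec_h : RecF1 h.
Hypothesis h0 : h 0 = 0.
Hypothesis h_inj : forall x y, h x = h y -> x = y.

(** A true stage is one that is never seen to be false in this sense: [h] does
    not fall below its value there. As [h] takes its least value at [0], the
    stage [0] is true. *)
Definition False_by (p s : M) : Prop := exists q, q < s + 1 /\ (p < q /\ h q < h p).

Lemma Rec2_False_by : Rec2 False_by.
Proof. unfold False_by. rec. Qed.
Hint Resolve Rec2_False_by : rec.

Lemma False_by_mono p s t : s <= t -> False_by p s -> False_by p t.
Proof.
  intros H [q [Hq K]]. exists q. split; trivial.
  apply lt_succ. apply lt_succ in Hq. exact (le_trans Hq H).
Qed.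

(** Distinct true stages are incomparable, whereas a false stage lies below all
    sufficiently late ones; only pairs with equal stages are compared by their
    second components. *)
Definition stage_le (p c p' c' : M) : Prop :=
  (p = p' /\ c <= c') \/ (p < p' /\ False_by p p').

Lemma stage_le_trans p c p' c' p'' c'' :
  stage_le p c p' c' -> stage_le p' c' p'' c'' -> stage_le p c p'' c''.
Proof.
  intros [[<- H]|[H F]] [[<- K]|[K G]].
  - left. split; trivial. exact (le_trans H K).
  - right. now split.
  - right. now split.
  - right. split; [exact (lt_trans H K)|]. now apply (False_by_mono (lt_le K)).
Qed.

Lemma stage_order_exists : exists Q R,
  (forall z, z ∈ Q <-> exists p c : M, z = pair p c) /\
  (forall z, z ∈ R <-> exists p c p' c',
     z = pair (pair p c) (pair p' c') /\ stage_le p c p' c').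
Proof.
  destruct (@comprehension M HM (fun z => exists p, p < z + 1 /\
      exists c, c < z + 1 /\ z = pair p c))
    as [Q HQ]; [rec|].
  destruct (@comprehension M HM (fun z => exists p, p < z + 1 /\ exists c, c < z + 1 /\
    exists p', p' < z + 1 /\ exists c', c' < z + 1 /\
    (z = pair (pair p c) (pair p' c') /\ ((p = p' /\ c <= c') \/ (p < p' /\ False_by p p')))))
    as [R HR]; [rec|].
  exists Q, R. split; intro z.
  - rewrite HQ. split.
    + intros [p [_ [c [_ H]]]]. now exists p, c.
    + intros [p [c ->]]. exists p. split; [apply pair_lt_succ|]. exists c.
      split; [apply pair_lt_succ|trivial].
  - rewrite HR. split.
    + intros [p [_ [c [_ [p' [_ [c' [_ H]]]]]]]]. now exists p, c, p', c'.
    + intros [p [c [p' [c' [-> H]]]]].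
      assert (L : forall x y z : M, x <= y -> y < z + 1 -> x < z + 1).
      { intros x y z. apply le_lt_trans. }
      exists p. split; [apply (L _ (pair p c)); [apply pair_le_l|apply pair_lt_succ]|].
      exists c. split; [apply (L _ (pair p c)); [apply pair_le_r|apply pair_lt_succ]|].
      exists p'. split; [apply (L _ (pair p' c')); [apply pair_le_l|apply pair_lt_succ]|].
      exists c'. split; [apply (L _ (pair p' c')); [apply pair_le_r|apply pair_lt_succ]|].
      now split.
Qed.

(** The pairs of a stage [p] that looks true at [s] with the least value of [h]
    after [p] up to [s]. There is no such value for [p = s]; then
    [h (s + 1) + 1] takes its place, since it exceeds all minima that will ever
    be paired with [s]. *)
Definition stage_mem (s z : M) : Prop :=
  exists p, p < s + 1 /\ (~ False_by p s /\ exists c, c < z + 1 /\ (z = pair p c /\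
    ((p = s /\ c = h (s + 1) + 1) \/
     (p < s /\ (exists q, q < s + 1 /\ (p < q /\ c = h q)) /\
       forall q, q < s + 1 -> p < q -> c <= h q)))).

Lemma Rec2_stage_mem : Rec2 stage_mem.
Proof. unfold stage_mem. rec. Qed.
Hint Resolve Rec2_stage_mem : rec.

(** The witness comes from the greatest [p] up to [s] that still looks true at
    [t]. Its pair in the later set has a smaller second component. If [p < s],
    the stage that gave the minimum at [s] has been seen to be false by [t],
    that is, a smaller value has appeared; if [p = s], the minimum is now at
    most [h (s + 1)]. *)
Lemma stage_sets_bad s t : s < t ->
  ~ (forall x, stage_mem s x -> exists p c p' c',
       x = pair p c /\ stage_mem t (pair p' c') /\ stage_le p c p' c').
Proof.
  intros Hst H.
  destruct (greatest (P := fun p => ~ False_by p t) (b := s)) as [p [Hps [Hp Hmax]]]; [rec| |].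
  { exists 0. split; [apply le_0|]. intros [q [_ [_ K]]]. rewrite h0 in K.
    exact (nlt_0 K). }
  assert (Hpt : p < t) by exact (le_lt_trans Hps Hst).
  assert (Hp' : ~ False_by p s).
  { intro F. apply Hp. exact (False_by_mono (lt_le Hst) F). }
  assert (C : exists c, ((p = s /\ c = h (s + 1) + 1) \/
     (p < s /\ (exists q, q < s + 1 /\ (p < q /\ c = h q)) /\
       forall q, q < s + 1 -> p < q -> c <= h q))).
  { destruct Hps as [K|K]; [|now exists (h (s + 1) + 1); left].
    destruct (least (P := fun c => exists q, q < s + 1 /\ (p < q /\ c = h q)))
      as [c [Hc Hc']]; [rec| |].
    - exists (h s), s. split; [apply lt_S|now split].
    - exists c. right. split; trivial. split; trivial. intros q Hq Hpq.
      apply not_lt. intro L. apply (Hc' _ L). exists q. now split. }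
  destruct C as [c Hc].
  destruct (H (pair p c)) as [p1 [c1 [p' [c' [E [HE O]]]]]].
  { exists p. split; [now apply lt_succ|]. split; trivial. exists c.
    split; [apply pair_lt_succ|]. now split. }
  apply pair_inj in E. destruct E as [<- <-].
  destruct HE as [p2 [Hp2 [F2 [c2 [_ [E HE]]]]]]. apply pair_inj in E. destruct E as [<- <-].
  apply lt_succ in Hp2.
  destruct O as [[<- O]|[_ F]]; [|exact (Hp (False_by_mono Hp2 F))].
  destruct HE as [[-> _]|[_ [_ HE]]]; [exact (lt_irrefl Hpt)|].
  destruct Hc as [[-> ->]|[K [[q [Hq [Hpq ->]]] _]]].
  - apply (lt_irrefl (x := c')).
    apply le_lt_trans with (h (s + 1)).
    + apply HE; [|apply lt_S]. apply lt_succ. now apply succ_le.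
    + apply succ_le. exact O.
  - apply lt_succ in Hq.
    destruct (NNPP _ (Hmax q Hpq Hq)) as [r [Hr [Hqr L]]].
    apply (lt_irrefl (x := h q)). apply le_lt_trans with (h r); trivial.
    apply le_trans with c'; trivial. apply HE; trivial. exact (lt_trans Hpq Hqr).
Qed.

(** To pick the code of the [s]-th set recursively, a bound for its elements is
    picked along with it. *)
Lemma stage_sets_sequence : exists F,
  (forall z : M, z ∈ F -> exists s c : M, z = pair s c) /\
  (forall s : M, exists c, pair s c ∈ F) /\
  (forall s c : M, pair s c ∈ F -> canonical_code c /\ forall x, code_mem x c <-> stage_mem s x).
Proof.
  destruct (@Rec_choice M HM (fun s v => exists K, K < v + 1 /\ exists c, c < v + 1 /\
    (v = pair K c /\ (forall q, q < s + 1 + 1 -> pair s (h q + 1) < K) /\ canonical_code c /\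
     (forall x, x < c -> code_mem x c -> stage_mem s x) /\
     (forall x, x < K -> stage_mem s x -> code_mem x c))))
    as [f [Rf Hf]].
  - rec.
  - intro s.
    destruct (@bounded_values M HM (fun q => pair s (h q + 1)) (s + 1 + 1)) as [K HK]; [rec|].
    destruct (@finite_set M HM (fun x => x < K /\ stage_mem s x) K) as [c [Fc Hc]]; [rec|tauto|].
    exists (pair K c), K. split; [apply pair_lt_succ|]. exists c.
    split; [apply pair_lt_succ|]. split; trivial. split; trivial. split; trivial.
    split; intros x Hx Hx'; now apply Hc.
  - destruct (@comprehension M HM (fun z => exists s, s < z + 1 /\ exists c, c < z + 1 /\
      exists K, K < f s + 1 /\ (z = pair s c /\ f s = pair K c))) as [F HF]; [rec|].
    exists F. split; [|split].
    + intros z Hz. apply HF in Hz. destruct Hz as [s [_ [c [_ [K [_ [-> _]]]]]]]. now exists s, c.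
    + intro s. destruct (Hf s) as [K [HK [c [_ [E _]]]]]. exists c. apply HF.
      exists s. split; [apply pair_lt_succ|]. exists c. split; [apply pair_lt_succ|].
      exists K. split; trivial. now split.
    + intros s c H. apply HF in H. destruct H as [s1 [_ [c1 [_ [K [_ [E E']]]]]]].
      apply pair_inj in E. destruct E as [<- <-].
      destruct (Hf s) as [K1 [_ [c1 [_ [E [HK [Fc [H H']]]]]]]]. rewrite E' in E.
      apply pair_inj in E. destruct E as [<- <-]. split; trivial.
      intro x. split.
      * intro Hx. apply H; trivial. now apply code_mem_lt.
      * intro Hx. apply H'; trivial.
        destruct Hx as [p [Hp [_ [d [_ [-> Hd]]]]]]. apply lt_succ in Hp.
        destruct Hd as [[-> ->]|[_ [[q [Hq [_ ->]]] _]]].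
        -- apply HK, lt_S.
        -- apply le_lt_trans with (pair s (h q + 1)).
           ++ apply pair_mono; [exact Hp|apply lt_le, lt_S].
           ++ apply HK. apply lt_trans with (s + 1); [trivial|apply lt_S].
Qed.

Hypothesis preserves : forall Q R : nat, @QuasiOrder M Q R -> @WellQuasiOrder M Q R ->
  exists P S, @Pf_flat M Q R P S /\ @WellQuasiOrder M P S.

(** Since the finite sets above form a bad sequence, the pairs are not
    well-quasi-ordered, and there is a bad sequence of pairs [(p i, c i)]. Bounded
    [p i] would lead to bounded [c i], as the second components decrease along
    equal stages, and the bad sequence would be an injection into a bounded set.
    So each [p i] has arbitrarily late successors, none of which sees it to be
    false, and it is true. On true stages [h] increases strictly. *)
Theorem true_stages : exists p,
  RecF1 p /\ (forall i q, p i < q -> h (p i) <= h q) /\ forall z, exists i, z <= h (p i).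
Proof.
  destruct stage_order_exists as [Q [R [HQ HR]]].
  assert (HR' : forall p c p' c', pair (pair p c) (pair p' c') ∈ R <-> stage_le p c p' c').
  { intros p c p' c'. rewrite HR. split.
    - intros [p1 [c1 [p2 [c2 [E H]]]]].
      apply pair_inj in E. destruct E as [E E'].
      apply pair_inj in E. apply pair_inj in E'. destruct E as [-> ->], E' as [-> ->].
      exact H.
    - intro H. now exists p, c, p', c'. }
  assert (qo : @QuasiOrder M Q R).
  { split; [|split].
    - intros z Hz. apply HR in Hz. destruct Hz as [p [c [p' [c' [-> _]]]]].
      exists (pair p c), (pair p' c'). rewrite !HQ. split; [now exists p, c|].
      split; [now exists p', c'|trivial].
    - intros z Hz. apply HQ in Hz. destruct Hz as [p [c ->]]. apply HR'. left.
      split; [trivial|apply le_refl].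
    - intros x y z [H K]. apply HR in H. destruct H as [p [c [p' [c' [E O]]]]].
      apply pair_inj in E. destruct E as [-> ->].
      apply HR in K. destruct K as [p1 [c1 [p'' [c'' [E O']]]]].
      apply pair_inj in E. destruct E as [E ->]. apply pair_inj in E. destruct E as [<- <-].
      apply HR'. exact (stage_le_trans O O'). }
  assert (bad : ~ @WellQuasiOrder M Q R).
  { intro W. destruct (preserves qo W) as [P [S [[HP HS] [_ WP]]]].
    destruct stage_sets_sequence as [F [HF1 [HF2 HF3]]].
    destruct (WP F) as [m [n [a [b [Hmn [Ha [Hb Hab]]]]]]].
    - split; [|split].
      + intros z Hz. destruct (HF1 z Hz) as [s [c ->]]. exists s, c. split; trivial.
        apply HP. destruct (HF3 s c Hz) as [Fc K]. split; trivial.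
        intros x Hx. apply K in Hx. destruct Hx as [p [_ [_ [d [_ [-> _]]]]]].
        apply HQ. now exists p, d.
      + exact HF2.
      + intros s c d [Hc Hd]. apply HF3 in Hc, Hd. destruct Hc as [Fc Hc], Hd as [Fd Hd].
        apply canonical_code_ext; trivial. intro x. now rewrite Hc, Hd.
    - apply HF3 in Ha, Hb. destruct Ha as [_ Ha], Hb as [_ Hb].
      apply HS in Hab. destruct Hab as [a' [b' [E [_ [_ Hab]]]]].
      apply pair_inj in E. destruct E as [<- <-].
      apply (stage_sets_bad Hmn). intros x Hx. apply Ha in Hx.
      destruct (Hab x Hx) as [y [Hy K]]. apply HR in K.
      destruct K as [p [c [p' [c' [E O]]]]]. apply pair_inj in E. destruct E as [-> ->].
      exists p, c, p', c'. split; trivial. split; trivial. now apply Hb. }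
  assert (seq : exists G, @SequenceIn M G Q /\ forall m n a b : M, m < n ->
    pair m a ∈ G -> pair n b ∈ G -> ~ pair a b ∈ R).
  { apply NNPP. intro N. apply bad. split; trivial. intros G HG. apply NNPP. intro N'.
    apply N. exists G. split; trivial. intros m n a b H1 H2 H3 H4. apply N'.
    now exists m, n, a, b. }
  destruct seq as [G [[HG1 [HG2 _]] HG]].
  destruct (@Rec_choice M HM (fun i z => pair i z ∈ G)) as [g [Rg Hg]]; [rec|exact HG2|].
  assert (Hg' : forall i, exists p c, g i = pair p c).
  { intro i. destruct (HG1 _ (Hg i)) as [j [x [Hx E]]]. apply pair_inj in E.
    destruct E as [_ <-]. now apply HQ. }
  destruct (@Rec_choice M HM (fun i p => exists c, c < g i + 1 /\ g i = pair p c))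
    as [p [Rp Hp]]; [rec| |].
  { intro i. destruct (Hg' i) as [p [c E]]. exists p, c. split; trivial. rewrite E.
    apply pair_lt_succ. }
  destruct (@Rec_choice M HM (fun i c => g i = pair (p i) c))
    as [c [Rc Hc]]; [rec| |].
  { intro i. destruct (Hp i) as [c [_ E]]. now exists c. }
  assert (Hbad : forall i j, i < j -> ~ stage_le (p i) (c i) (p j) (c j)).
  { intros i j Hij O. apply (HG i j (g i) (g j) Hij (Hg i) (Hg j)).
    rewrite !Hc. now apply HR'. }
  assert (unbounded : forall b, exists i, b <= p i).
  { intro b. apply NNPP. intro N.
    assert (Hb : forall i, p i < b).
    { intro i. apply not_le. intro K. apply N. now exists i. }
    destruct (values_exhausted Rp Hb) as [u Hu].
    destruct (bounded_values u Rc) as [v Hv].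
    assert (HV : forall j, c j < v).
    { intro j. destruct (Hu j) as [i [Hi E]].
      destruct (le_or_lt j i) as [K|K]; [apply Hv; exact (le_lt_trans K Hi)|].
      apply lt_trans with (c i); [|now apply Hv].
      apply not_le. intro L. apply (Hbad i j K). left. now split. }
    destruct (values_exhausted (g := g) (b := pair b v + 1) Rg) as [u' Hu'].
    { intro j. rewrite Hc. apply lt_succ, pair_mono; apply lt_le; trivial. }
    destruct (Hu' u') as [i [Hi E]]. rewrite !Hc in E. apply pair_inj in E.
    apply (Hbad i u' Hi). left. destruct E as [-> ->]. split; [trivial|apply le_refl]. }
  assert (true : forall i q, p i < q -> h (p i) <= h q).
  { intros i q Hq. destruct (bounded_values (i + 1) Rp) as [b Hb].
    destruct (unbounded (q + b)) as [j Hj].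
    assert (Hij : i < j).
    { apply not_le. intro K. apply (lt_irrefl (x := p j)).
      apply lt_le_trans with b; [apply Hb; now apply lt_succ|].
      apply le_trans with (q + b); [apply le_add_l|exact Hj]. }
    apply not_lt. intro L. apply (Hbad i j Hij). right.
    assert (K : q <= p j) by (apply le_trans with (q + b); [apply le_add_r|exact Hj]).
    split; [exact (lt_le_trans Hq K)|]. exists q. split; [now apply lt_succ|now split]. }
  exists p. split; trivial. split; trivial.
  apply (Def1_ind (P := fun z => exists i, z <= h (p i))).
  - rec.
  - exists 0. apply le_0.
  - intros z [i Hi]. destruct (unbounded (p i + 1)) as [j Hj]. apply succ_le in Hj.
    exists j. apply succ_le. apply le_lt_trans with (h (p i)); trivial.
    destruct (true i (p j) Hj) as [K|K]; trivial.
    apply h_inj in K. rewrite K in Hj. destruct (lt_irrefl Hj).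
Qed.

End TrueStages.

Hypothesis preserves : forall Q R : nat, @QuasiOrder M Q R -> @WellQuasiOrder M Q R ->
  exists P S, @Pf_flat M Q R P S /\ @WellQuasiOrder M P S.

(** The stage [pair x (y + 1)] enumerates [x] if [y] is the least witness; all
    other stages take a value of their own, which makes [h] injective. After a
    true stage with value above [pair 1 x] the number [x] is no longer
    enumerated, so that membership is decided by a bounded search. *)
Theorem Sigma1_comprehension (B : M -> M -> Prop) : Rec2 B ->
  exists A, forall x, x ∈ A <-> exists y, B x y.
Proof.
  intro HB.
  (* The successor of y keeps stage 0 from enumerating, so that h 0 = 0. *)
  set (enumerates := fun i x => exists y, y < i /\
    (i = pair x (y + 1) /\ B x y /\ forall z, z < y -> ~ B x z)).
  assert (Re : Rec2 enumerates) by (unfold enumerates; rec).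
  destruct (@Rec_choice M HM (fun i v =>
    (exists x, x < i + 1 /\ (enumerates i x /\ v = pair 1 x)) \/
    (~ (exists x, x < i + 1 /\ enumerates i x) /\ v = pair 0 i))) as [h [Rh Hh]]; [rec| |].
  { intro i. destruct (classic (exists x, x < i + 1 /\ enumerates i x)) as [[x [Hx K]]|N].
    - exists (pair 1 x). left. now exists x.
    - exists (pair 0 i). now right. }
  assert (ne : (0 : M) <> 1) by (apply lt_ne, lt01).
  assert (h0 : h 0 = 0).
  { destruct (Hh 0) as [[x [_ [[y [Hy _]] _]]]|[_ ->]]; [destruct (nlt_0 Hy)|].
    unfold pair. ring. }
  assert (inj : forall i j, h i = h j -> i = j).
  { intros i j E.
    destruct (Hh i) as [[x [_ [[y [_ [-> [Bx Ly]]]] Ei]]]|[_ Ei]];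
    destruct (Hh j) as [[x' [_ [[y' [_ [-> [Bx' Ly']]]] Ej]]]|[_ Ej]];
      rewrite Ei, Ej in E; apply pair_inj in E; destruct E as [E E'];
      [|destruct (ne (eq_sym E))|destruct (ne E)|exact E'].
    subst x'. destruct (lt_total y y') as [K|[->|K]]; trivial.
    - destruct (Ly' _ K Bx).
    - destruct (Ly _ K Bx'). }
  assert (en : forall x, (exists y, B x y) <-> exists i, h i = pair 1 x).
  { intro x. split.
    - intro H. destruct (least (P := B x)) as [y [Hy Ly]]; [rec|exact H|].
      assert (K : enumerates (pair x (y + 1)) x).
      { exists y. split; [|now split].
        apply lt_le_trans with (y + 1); [apply lt_S|apply pair_le_r]. }
      exists (pair x (y + 1)).
      destruct (Hh (pair x (y + 1))) as [[x' [_ [[y' [_ [E _]]] ->]]]|[N _]].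
      + apply pair_inj in E. destruct E as [-> _]. reflexivity.
      + destruct N. exists x. split; [apply pair_lt_succ|exact K].
    - intros [i Hi]. destruct (Hh i) as [[x' [_ [[y [_ [_ [Bx _]]]] E]]]|[_ E]];
        rewrite Hi in E; apply pair_inj in E; destruct E as [E E'].
      + subst x'. now exists y.
      + destruct (ne (eq_sym E)). }
  destruct (true_stages Rh h0 inj preserves) as [p [Rp [Hp Hu]]].
  assert (char : forall x i, pair 1 x < h (p i) ->
    ((exists y, B x y) <-> exists k, k < p i + 1 /\ h k = pair 1 x)).
  { intros x i Hi. rewrite en. split.
    - intros [k Hk]. exists k. split; trivial. apply lt_succ, not_lt. intro K.
      apply Hp in K. rewrite Hk in K. exact (lt_not_le Hi K).
    - intros [k [_ Hk]]. now exists k. }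
  assert (large : forall x, exists i, pair 1 x < h (p i)).
  { intro x. destruct (Hu (pair 1 x + 1)) as [i Hi]. exists i. now apply succ_le. }
  destruct (@Delta1_comprehension M HM (fun x => exists y, B x y)) as [A HA].
  - rec.
  - apply (Def1_ext (P := fun e => exists i, pair 1 (e O) < h (p i) /\
      ~ exists k, k < p i + 1 /\ h k = pair 1 (e O))); [|rec].
    intro e. split.
    + intros [i [Hi N]]. now rewrite (char _ i Hi).
    + intro N. destruct (large (e O)) as [i Hi]. exists i. split; trivial.
      now rewrite <- (char _ i Hi).
  - now exists A.
Qed.

End Reversal.

(** * Arithmetical comprehension in a model *)

Section Arithmetical.

Context {M : model} {HM : rca0 M}.

Add Ring M_ring4 : (@M_semiring M HM).

Lemma projections : exists p1 p2 : M -> M, RecF1 p1 /\ RecF1 p2 /\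
  forall x y, p1 (pair x y) = x /\ p2 (pair x y) = y.
Proof.
  destruct (@Rec_choice M HM (fun w x => (exists y, y < w + 1 /\ w = pair x y) \/
    ~ exists x, x < w + 1 /\ exists y, y < w + 1 /\ w = pair x y)) as [p1 [R1 H1]]; [rec| |].
  { intro w. destruct (classic (exists x, x < w + 1 /\ exists y, y < w + 1 /\ w = pair x y))
      as [[x [_ K]]|N]; [exists x; now left|exists 0; now right]. }
  destruct (@Rec_choice M HM (fun w y => (exists x, x < w + 1 /\ w = pair x y) \/
    ~ exists x, x < w + 1 /\ exists y, y < w + 1 /\ w = pair x y)) as [p2 [R2 H2]]; [rec| |].
  { intro w. destruct (classic (exists x, x < w + 1 /\ exists y, y < w + 1 /\ w = pair x y))
      as [[x [Hx [y [_ K]]]]|N]; [exists y; left; now exists x|exists 0; now right]. }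
  exists p1, p2. split; trivial. split; trivial. intros x y.
  assert (L : exists x', x' < pair x y + 1 /\ exists y', y' < pair x y + 1 /\
    pair x y = pair x' y').
  { exists x. split; [apply pair_lt_succ|]. exists y. split; [apply pair_lt_succ|trivial]. }
  destruct (H1 (pair x y)) as [[y' [_ E1]]|N]; [|contradiction].
  destruct (H2 (pair x y)) as [[x' [_ E2]]|N]; [|contradiction].
  apply pair_inj in E1, E2. destruct E1, E2. now split.
Qed.

Variables p1 p2 : M -> M.
Hypothesis R1 : RecF1 p1.
Hypothesis R2 : RecF1 p2.
Hypothesis p12 : forall x y, p1 (pair x y) = x /\ p2 (pair x y) = y.

Hypothesis Sigma1 : forall B : M -> M -> Prop, Rec2 B ->
  exists A, forall x, x ∈ A <-> exists y, B x y.

Lemma Rec1_ex (B : M -> M -> Prop) : Rec2 B -> Rec1 (fun x => exists y, B x y).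
Proof.
  intro H. destruct (Sigma1 H) as [A HA].
  apply (Rec_ext (P := fun e => e O ∈ A)); [intro; apply HA|rec].
Qed.

Lemma Rec2_ex (B : M -> M -> M -> Prop) :
  Rec3 B -> Rec2 (fun x y => exists z, B x y z).
Proof.
  intro H. destruct (Sigma1 (B := fun w z => B (p1 w) (p2 w) z)) as [A HA]; [rec|].
  apply (Rec_ext (P := fun e => pair (e O) (e 1%nat) ∈ A)); [|rec].
  intro e. rewrite HA. destruct (p12 (e O) (e 1%nat)) as [-> ->]. reflexivity.
Qed.

Lemma RecT_teval (t : nat -> M -> M) (u : term) :
  (forall i, RecF1 (t i)) -> RecF1 (fun z => teval M (fun i => t i z) u).
Proof.
  intro H. induction u; cbn [teval].
  - apply H.
  - rec.
  - rec.
  - exact (RecF2_app RecF2_plus IHu1 IHu2).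
  - exact (RecF2_app RecF2_mult IHu1 IHu2).
Qed.

(** All number variables are recursive functions of one number [z]. This form is
    preserved under quantifiers: the bound number is paired with [z], and the
    quantifier over it is removed by [Sigma^0_1] comprehension. *)
Lemma arithmetical_Rec phi : arithmetical phi -> forall (t : nat -> M -> M) E,
  (forall i, RecF1 (t i)) -> Rec1 (fun z => sat M (fun i => t i z) E phi).
Proof.
  induction phi as [|u v|u v|u X|phi IH psi IH'|phi IH|phi IH]; cbn [arithmetical sat];
    intros A t E Ht; try contradiction.
  - rec.
  - assert (Hu := RecT_teval u Ht). assert (Hv := RecT_teval v Ht).
    unfold Rec1. exact (Rec2_app Rec2_eq Hu Hv).
  - assert (Hu := RecT_teval u Ht). assert (Hv := RecT_teval v Ht).
    unfold Rec1. exact (Rec2_app Rec2_lt Hu Hv).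
  - assert (Hu := RecT_teval u Ht). exact (Rec1_app (Rec1_mem (E X)) Hu).
  - destruct A as [A A']. exact (Rec_imp (IH A t E Ht) (IH' A' t E Ht)).
  - assert (H : Rec1 (fun w => sat M (scons (p2 w) (fun i => t i (p1 w))) E phi)).
    { apply (Rec_ext (P := fun e => sat M (fun i =>
        (match i with O => p2 | S i => fun w => t i (p1 w) end) (e O)) E phi)).
      - intro e. replace (scons (p2 (e O)) (fun i => t i (p1 (e O)))) with (fun i =>
          (match i with O => p2 | S i => fun w => t i (p1 w) end) (e O)); [reflexivity|].
        apply functional_extensionality. intros [|i]; reflexivity.
      - apply (IH A (fun i => match i with O => p2 | S i => fun w => t i (p1 w) end)).
        intros [|i]; [exact R2|]. specialize (Ht i). rec. }
    assert (B : Rec2 (fun z x => ~ sat M (scons x (fun i => t i z)) E phi)).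
    { apply (Rec_ext (P := fun e => ~ (fun w => sat M (scons (p2 w) (fun i => t i (p1 w))) E phi)
        (pair (e O) (e 1%nat)))).
      - intro e. cbv beta. destruct (p12 (e O) (e 1%nat)) as [-> ->]. reflexivity.
      - apply Rec_not.
        apply (Rec1_app (R := fun w => sat M (scons (p2 w) (fun i => t i (p1 w))) E phi)
          (t := fun e => pair (e O) (e 1%nat)) H).
        rec. }
    apply Rec1_ex in B.
    apply (Rec_ext (P := fun e => ~ exists y, ~ sat M (scons y (fun i => t i (e O))) E phi)).
    + intro e. split.
      * intros N x. apply NNPP. intro N'. apply N. now exists x.
      * intros N [x Hx]. exact (Hx (N x)).
    + exact (Rec_not B).
Qed.

Theorem arithmetical_comprehension phi e E :
  arithmetical phi -> sat M e E (comprehension_for phi).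
Proof.
  intro A. apply sat_comprehension_for.
  apply (comprehension (P := fun x => sat M (scons x e) E phi)).
  apply (Rec_ext (P := fun e' => sat M (fun i =>
    (match i with O => fun x => x | S i => fun _ => e i end) (e' O)) E phi)).
  - intro e'. replace (scons (e' O) e) with (fun i =>
      (match i with O => fun x => x | S i => fun _ => e i end) (e' O)); [reflexivity|].
    apply functional_extensionality. intros [|i]; reflexivity.
  - apply (arithmetical_Rec A
      (t := fun i => match i with O => fun x => x | S i => fun _ => e i end)).
    intros [|i]; rec.
Qed.

(** * Primitive recursion *)

Section Recursion.

Variable g : M -> M.
Hypothesis Rg : RecF1 g.
Variable a : M.

(** A coded set of pairs, each justified by the recursion equations from the
    other pairs. That it is part of the graph of one function follows from this
    by induction. *)
Definition History (c : M) : Prop :=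
  forall j, j < c -> forall y, y < c -> code_mem (pair j y) c ->
    (j = 0 /\ y = a) \/
    exists k, k < j /\ (j = k + 1 /\ exists z, z < c /\ (code_mem (pair k z) c /\ y = g z)).

Lemma Rec1_History : Rec1 History.
Proof. unfold History. rec. Qed.
Hint Resolve Rec1_History : rec.

Lemma History_spec c j y : History c -> code_mem (pair j y) c ->
  (j = 0 /\ y = a) \/ exists k z, j = k + 1 /\ code_mem (pair k z) c /\ y = g z.
Proof.
  intros H F. assert (L := code_mem_lt F). destruct (H j) with (y := y) as [K|K]; trivial.
  - exact (le_lt_trans (pair_le_l _ _) L).
  - exact (le_lt_trans (pair_le_r _ _) L).
  - now left.
  - right. destruct K as [k [_ [E [z [_ K]]]]]. exists k, z. now split.
Qed.

Lemma History_unique c d : History c -> History d -> forall j y y',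
  code_mem (pair j y) c -> code_mem (pair j y') d -> y = y'.
Proof.
  intros Hc Hd.
  enough (K : forall j y, y < c -> forall y', y' < d ->
      code_mem (pair j y) c -> code_mem (pair j y') d -> y = y').
  { intros j y y' F F'. apply (K j); trivial.
    - exact (le_lt_trans (pair_le_r _ _) (code_mem_lt F)).
    - exact (le_lt_trans (pair_le_r _ _) (code_mem_lt F')). }
  apply (Rec_ind (P := fun j => forall y, y < c -> forall y', y' < d ->
      code_mem (pair j y) c -> code_mem (pair j y') d -> y = y')).
  - rec.
  - intros y _ y' _ F F'.
    destruct (History_spec Hc F) as [[_ ->]|[k [z [E _]]]].
    + destruct (History_spec Hd F') as [[_ ->]|[k [z [E _]]]]; trivial.
      destruct (lt_ne (lt_0_succ k) E).
    + destruct (lt_ne (lt_0_succ k) E).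
  - intros j IH y _ y' _ F F'.
    destruct (History_spec Hc F) as [[E _]|[k [z [E [K ->]]]]];
      [destruct (lt_ne (lt_0_succ j) (eq_sym E))|].
    destruct (History_spec Hd F') as [[E' _]|[k' [z' [E' [K' ->]]]]];
      [destruct (lt_ne (lt_0_succ j) (eq_sym E'))|].
    apply succ_inj in E, E'. subst k k'. f_equal. apply IH; trivial.
    + exact (le_lt_trans (pair_le_r _ _) (code_mem_lt K)).
    + exact (le_lt_trans (pair_le_r _ _) (code_mem_lt K')).
Qed.

Lemma History_exists : forall i, exists y c, History c /\ code_mem (pair i y) c.
Proof.
  apply (Def1_ind (P := fun i => exists y, exists c, History c /\ code_mem (pair i y) c)).
  - rec.
  - destruct (@finite_set M HM (fun x => x = pair 0 a) (pair 0 a + 1)) as [c [_ Hc]]; [rec| |].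
    { intros x ->. apply lt_S. }
    exists a, c. split; [|now apply Hc].
    intros j _ y _ F. apply Hc in F. apply pair_inj in F. now left.
  - intros i [y [c [Hc F]]].
    destruct (@finite_set M HM (fun x => code_mem x c \/ x = pair (i + 1) (g y))
      (c + pair (i + 1) (g y) + 1)) as [d [_ Hd]]; [rec| |].
    { intros x [K| ->]; apply lt_succ.
      - apply le_trans with c; [exact (lt_le (code_mem_lt K))|apply le_add_r].
      - apply le_add_l. }
    assert (L : forall k z, code_mem (pair k z) c -> z < d).
    { intros k z K. apply le_lt_trans with (pair k z); [apply pair_le_r|].
      apply code_mem_lt, Hd. now left. }
    exists (g y), d. split; [|apply Hd; now right].
    intros j _ w _ K. apply Hd in K. destruct K as [K|K].
    + destruct (History_spec Hc K) as [K'|[k [z [-> [K' E]]]]]; [now left|].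
      right. exists k. split; [apply lt_S|]. split; trivial. exists z.
      split; [exact (L _ _ K')|]. split; trivial. apply Hd. now left.
    + apply pair_inj in K. destruct K as [-> ->]. right. exists i. split; [apply lt_S|].
      split; trivial. exists y. split; [exact (L _ _ F)|]. split; trivial. apply Hd. now left.
Qed.

(** The graph is [Sigma^0_1]: the value is the one in some history. *)
Theorem recursion : exists f, RecF1 f /\ f 0 = a /\ forall i, f (i + 1) = g (f i).
Proof.
  destruct (choice _ History_exists) as [f Hf]. exists f. split; [|split].
  - apply (Def1_ext (P := fun e => exists c,
      History c /\ code_mem (pair (e 1%nat) (e O)) c)); [|rec].
    intro e. destruct (Hf (e 1%nat)) as [d [Hd F]]. split.
    + intros [c [Hc F']]. exact (History_unique Hc Hd F' F).
    + intro E. exists d. split; trivial. rewrite E. exact F.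
  - destruct (Hf 0) as [c [Hc F]].
    destruct (History_spec Hc F) as [[_ E]|[k [z [E _]]]]; trivial.
    destruct (lt_ne (lt_0_succ k) E).
  - intro i. destruct (Hf (i + 1)) as [c [Hc F]], (Hf i) as [d [Hd F']].
    destruct (History_spec Hc F) as [[E _]|[k [z [E [K ->]]]]].
    + destruct (lt_ne (lt_0_succ i) (eq_sym E)).
    + apply succ_inj in E. subst k. f_equal. exact (History_unique Hc Hd K F').
Qed.

End Recursion.

(** * Finite powersets of well-quasi-orders *)

Lemma Pf_flat_exists Q R : exists P S, @Pf_flat M Q R P S.
Proof.
  destruct (@comprehension M HM (fun c => canonical_code c /\
      forall x, x < c -> code_mem x c -> x ∈ Q))
    as [P HP]; [rec|].
  destruct (@comprehension M HM (fun z => exists a, a < z + 1 /\ exists b, b < z + 1 /\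
    (z = pair a b /\ a ∈ P /\ b ∈ P /\ forall x, x < a -> code_mem x a ->
       exists y, y < b /\ (code_mem y b /\ pair x y ∈ R)))) as [S HS]; [rec|].
  exists P, S. split.
  - intro c. rewrite HP. split; intros [H K]; (split; [exact H|]).
    + intros x Hx. apply K; trivial. now apply code_mem_lt.
    + intros x _ Hx. now apply K.
  - intro z. rewrite HS. split.
    + intros [a [_ [b [_ [-> [Ha [Hb K]]]]]]]. exists a, b. repeat (split; trivial).
      intros x Hx. destruct (K x (code_mem_lt Hx) Hx) as [y [_ H]]. now exists y.
    + intros [a [b [-> [Ha [Hb K]]]]]. exists a. split; [apply pair_lt_succ|].
      exists b. split; [apply pair_lt_succ|]. repeat (split; trivial).
      intros x _ Hx. destruct (K x Hx) as [y [H H']]. exists y.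
      split; [exact (code_mem_lt H)|now split].
Qed.

Lemma Pf_flat_QuasiOrder Q R P S : @QuasiOrder M Q R -> @Pf_flat M Q R P S -> @QuasiOrder M P S.
Proof.
  intros [HR [Hrefl Htrans]] [HP HS]. split; [|split].
  - intros z Hz. apply HS in Hz. destruct Hz as [a [b [-> [Ha [Hb _]]]]]. now exists a, b.
  - intros a Ha. apply HS. exists a, a. repeat (split; trivial).
    intros x Hx. exists x. split; trivial. apply Hrefl. now apply HP in Ha; apply Ha.
  - intros a b c [H K]. apply HS in H, K.
    destruct H as [a' [b' [E [Ha [_ H]]]]]. apply pair_inj in E. destruct E as [<- <-].
    destruct K as [b' [c' [E [_ [Hc K]]]]]. apply pair_inj in E. destruct E as [<- <-].
    apply HS. exists a, c. repeat (split; trivial).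
    intros x Hx. destruct (H x Hx) as [y [Hy Hxy]]. destruct (K y Hy) as [z [Hz Hyz]].
    exists z. split; trivial. apply (Htrans x y z). now split.
Qed.

Section BadSequence.

Variables (R : nat) (a : M -> M).
Hypothesis Ra : RecF1 a.
Hypothesis bad : forall m n, m < n -> ~ below R (a m) (a n).

Definition avoids (n c : M) : Prop :=
  forall x, x < c -> code_mem x c -> forall y, y < a n -> code_mem y (a n) -> ~ pair x y ∈ R.

Definition avoids1 (n x : M) : Prop :=
  forall y, y < a n -> code_mem y (a n) -> ~ pair x y ∈ R.

Lemma Rec2_avoids : Rec2 avoids.
Proof. unfold avoids. rec. Qed.
Lemma Rec2_avoids1 : Rec2 avoids1.
Proof. unfold avoids1. rec. Qed.
Hint Resolve Rec2_avoids Rec2_avoids1 : rec.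

(** A set [c] is good if infinitely many [a n] avoid it. The negations put the
    definition into the form of two applications of [Sigma^0_1] comprehension. *)
Definition Good (c : M) : Prop := ~ exists b, ~ exists n, b < n /\ avoids n c.

Lemma Rec1_Good : Rec1 Good.
Proof.
  apply Rec_not, (Rec1_ex (B := fun c b => ~ exists n, b < n /\ avoids n c)), Rec_not.
  apply (Rec2_ex (B := fun c b n => b < n /\ avoids n c)). rec.
Qed.
Hint Resolve Rec1_Good : rec.

Lemma Good_spec c : Good c <-> forall b, exists n, b < n /\ avoids n c.
Proof.
  split.
  - intros H b. apply NNPP. intro N. apply H. now exists b.
  - intros H [b N]. exact (N (H b)).
Qed.

Lemma insert_exists (c x : M) : exists d, forall y, code_mem y d <-> code_mem y c \/ y = x.
Proof.
  destruct (@finite_set M HM (fun y => code_mem y c \/ y = x) (c + x + 1)) as [d [_ Hd]].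
  - rec.
  - intros y [K| ->]; apply lt_succ.
    + apply le_trans with c; [exact (lt_le (code_mem_lt K))|apply le_add_r].
    + apply le_add_l.
  - now exists d.
Qed.

(** If no element [x] of [a n] could be added to [c], then for each of these
    finitely many [x], only boundedly many [a m] that avoid [c] would avoid [x];
    some later [a m] that avoids [c] would avoid no element of [a n], that is,
    [a n] would be below [a m]. *)
Lemma Good_step c : Good c ->
  exists n x d, code_mem x (a n) /\ avoids n c /\ Good d /\
    forall y, code_mem y d <-> code_mem y c \/ y = x.
Proof.
  intro Gc. rewrite Good_spec in Gc. destruct (Gc 0) as [n [_ Hn]].
  apply NNPP. intro N.
  destruct (@bounding M HM (fun x b => code_mem x (a n) ->
     ~ exists m, b < m /\ (avoids m c /\ avoids1 m x)) (a n)) as [z Hz].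
  - assert (K := Rec2_ex (B := fun x b m => b < m /\ (avoids m c /\ avoids1 m x)) ltac:(rec)).
    apply Rec_imp; [rec|apply Rec_not, K].
  - intros x _. destruct (classic (code_mem x (a n))) as [Hx|Hx]; [|now exists 0].
    destruct (insert_exists c x) as [d Hd].
    apply NNPP. intro N'. apply N. exists n, x, d. split; trivial. split; trivial.
    split; trivial. apply Good_spec. intro b. apply NNPP. intro L. apply N'.
    exists b. intros _ [m [Hm [A A1]]]. apply L. exists m. split; trivial.
    intros w _ Hw. apply Hd in Hw. destruct Hw as [Hw| ->]; [|exact A1].
    apply A; trivial. now apply code_mem_lt.
  - destruct (Gc (z + n)) as [m [Hm Am]].
    apply (bad (m := n) (n := m)); [exact (le_lt_trans (le_add_l _ _) Hm)|].
    intros x Hx. apply NNPP. intro L.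
    destruct (Hz x (code_mem_lt Hx)) as [b [Hb K]]. apply (K Hx). exists m. split.
    { apply lt_trans with z; trivial. exact (le_lt_trans (le_add_r _ _) Hm). }
    split; trivial. intros y _ Hy Hxy. apply L. now exists y.
Qed.

(** The state of the recursion is the pair of the element chosen last and the
    good set of all elements chosen so far. *)
Lemma bad_elements : exists X n : M -> M, RecF1 X /\
  (forall i, code_mem (X i) (a (n i))) /\ forall i j, i < j -> ~ pair (X i) (X j) ∈ R.
Proof.
  set (step := fun w v => exists n, code_mem (p1 v) (a n) /\ avoids n (p2 w) /\ Good (p2 v) /\
    forall y, y < p2 v + p2 w + p1 v + 1 ->
      (code_mem y (p2 v) <-> code_mem y (p2 w) \/ y = p1 v)).
  assert (Rs : Rec2 step).
  { apply (Rec2_ex (B := fun w v n => code_mem (p1 v) (a n) /\ avoids n (p2 w) /\ Good (p2 v) /\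
      forall y, y < p2 v + p2 w + p1 v + 1 ->
        (code_mem y (p2 v) <-> code_mem y (p2 w) \/ y = p1 v))).
    rec. }
  destruct (@Rec_choice M HM (fun w v => Good (p2 w) -> step w v)) as [g [Rg Hg]]; [rec| |].
  { intro w. destruct (classic (Good (p2 w))) as [G|G]; [|now exists 0].
    destruct (Good_step G) as [n [x [d [Hx [A [Gd Hd]]]]]]. exists (pair x d). intros _.
    exists n. destruct (p12 x d) as [-> ->]. repeat (split; trivial); apply Hd. }
  destruct (@finite_set M HM (fun _ => False) 0) as [c0 [_ Hc0]]; [rec|tauto|].
  destruct (recursion Rg (pair 0 c0)) as [f [Rf [f0 fS]]].
  assert (G : forall i, Good (p2 (f i))).
  { apply (Rec_ind (P := fun i => Good (p2 (f i)))); [rec| |].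
    - rewrite f0. destruct (p12 0 c0) as [_ ->]. apply Good_spec. intro b.
      exists (b + 1). split; [apply lt_S|]. intros x _ Hx. now apply Hc0 in Hx.
    - intros i Gi. rewrite fS. destruct (Hg _ Gi) as [n [_ [_ [K _]]]]. exact K. }
  assert (St : forall i, exists n, code_mem (p1 (f (i + 1))) (a n) /\ avoids n (p2 (f i)) /\
    forall y, code_mem y (p2 (f (i + 1))) <-> code_mem y (p2 (f i)) \/ y = p1 (f (i + 1))).
  { intro i. rewrite fS. destruct (Hg _ (G i)) as [n [H1 [H2 [_ H3]]]]. exists n.
    split; trivial. split; trivial. set (v := g (f i)) in *. intro y.
    destruct (le_or_lt (p2 v + p2 (f i) + p1 v + 1) y) as [L|L]; [|now apply H3].
    assert (L1 : p2 v < y).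
    { apply lt_le_trans with (p2 v + p2 (f i) + p1 v + 1); trivial.
      apply lt_succ. rewrite addA. apply le_add_r. }
    assert (L2 : p2 (f i) < y).
    { apply lt_le_trans with (p2 v + p2 (f i) + p1 v + 1); trivial.
      apply lt_succ. rewrite (addC (p2 v)), addA. apply le_add_r. }
    assert (L3 : p1 v < y).
    { apply lt_le_trans with (p2 v + p2 (f i) + p1 v + 1); trivial.
      apply lt_succ. apply le_add_l. }
    split.
    - intro K. destruct (lt_irrefl (lt_trans L1 (code_mem_lt K))).
    - intros [K| ->]; [destruct (lt_irrefl (lt_trans L2 (code_mem_lt K)))|].
      destruct (lt_irrefl L3). }
  destruct (choice _ St) as [n Hn].
  exists (fun i => p1 (f (i + 1))), n. split; [|split].
  - rec.
  - intro i. apply Hn.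
  - intros i j Hij HR.
    assert (K : forall j, i < j -> code_mem (p1 (f (i + 1))) (p2 (f j))).
    { clear j Hij HR. apply (Rec_ind (P := fun j => i < j -> code_mem (p1 (f (i + 1))) (p2 (f j)))).
      - rec.
      - intro L. destruct (nlt_0 L).
      - intros j IH L. apply Hn. apply lt_succ in L.
        destruct L as [L| ->]; [left; auto|now right]. }
    destruct (Hn j) as [H1 [H2 _]]. specialize (K j Hij).
    exact (H2 _ (code_mem_lt K) K _ (code_mem_lt H1) H1 HR).
Qed.

End BadSequence.

Theorem Pf_flat_WellQuasiOrder Q R P S :
  @WellQuasiOrder M Q R -> @Pf_flat M Q R P S -> @WellQuasiOrder M P S.
Proof.
  intros [qo W] H. split; [exact (Pf_flat_QuasiOrder qo H)|].
  destruct H as [HP HS]. intros F [HF1 [HF2 _]]. apply NNPP. intro N.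
  destruct (@Rec_choice M HM (fun i c => pair i c ∈ F)) as [a [Ra Ha]]; [rec|exact HF2|].
  assert (HaP : forall i, a i ∈ P).
  { intro i. destruct (HF1 _ (Ha i)) as [j [c [Hc E]]]. apply pair_inj in E.
    destruct E as [_ <-]. exact Hc. }
  destruct (@bad_elements R a Ra) as [X [n [RX [HX bad]]]].
  { intros i j Hij B. apply N. exists i, j, (a i), (a j). split; trivial.
    split; [apply Ha|]. split; [apply Ha|]. apply HS. exists (a i), (a j).
    repeat (split; trivial). }
  destruct (@comprehension M HM (fun z => exists i, i < z + 1 /\ z = pair i (X i)))
    as [G HG]; [rec|].
  assert (HG' : forall i x, pair i x ∈ G -> x = X i).
  { intros i x K. apply HG in K. destruct K as [j [_ E]]. apply pair_inj in E.
    now destruct E as [<- ->]. }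
  destruct (W G) as [i [j [x [y [Hij [Hx [Hy Hxy]]]]]]].
  - split; [|split].
    + intros z Hz. apply HG in Hz. destruct Hz as [i [_ ->]]. exists i, (X i).
      split; trivial. apply (proj2 (proj1 (HP _) (HaP (n i)))), HX.
    + intro i. exists (X i). apply HG. exists i. split; [apply pair_lt_succ|trivial].
    + intros i x y [K L]. rewrite (HG' _ _ K). symmetry. exact (HG' _ _ L).
  - apply HG' in Hx, Hy. subst. exact (bad i j Hij Hxy).
Qed.

End Arithmetical.

(** * The equivalence *)

Lemma Sigma00_arithmetical phi : Sigma00 phi -> arithmetical phi.
Proof. induction 1; simpl; tauto. Qed.

Lemma aca0_Sigma1 {M : model} {HM : rca0 M} : models M ACA0 ->
  forall B : M -> M -> Prop, Rec2 B -> exists A, forall x, x ∈ A <-> exists y, B x y.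
Proof.
  intros HA B HB.
  assert (D : Def1 (fun e : env M => exists y, B (e O) y)) by rec.
  destruct (Def1_formula D) as [phi [Sg H]].
  assert (K := fun x => holds_params (P := fun x => exists y, B x y) x H).
  assert (A : arithmetical phi).
  { destruct Sg as [th [Sg ->]]. simpl. split; trivial. split; trivial.
    now apply Sigma00_arithmetical. }
  assert (C := HA _ (ACA0_comprehension phi A) params (fun X => X)).
  apply sat_comprehension_for in C. destruct C as [X HX]. exists X. intro x.
  now rewrite HX, K.
Qed.

Theorem theorem2p5 :
  equivalent_over RCA0 ACA0 (fun phi => phi = Pf_flat_preserves_wqo).
Proof.
  split.
  - intros phi ->. apply completeness. intros M HM' e E.
    assert (HM : rca0 M) by (intros psi H; apply HM'; now left).
    assert (HA : models M ACA0) by (intros psi H; apply HM'; now right).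
    destruct (@projections M HM) as [p1 [p2 [R1 [R2 p12]]]].
    apply sat_Pf_flat_preserves_wqo. intros Q R qo W.
    destruct (@Pf_flat_exists M HM Q R) as [P [S H]]. exists P, S. split; trivial.
    exact (Pf_flat_WellQuasiOrder R1 R2 p12 (aca0_Sigma1 HA) W H).
  - intros phi [psi H|psi A].
    +  apply prv_ax. now left.
    + apply completeness. intros M HM' e E.
      assert (HM : rca0 M) by (intros chi H; apply HM'; now left).
      destruct (@projections M HM) as [p1 [p2 [R1 [R2 p12]]]].
      apply (arithmetical_comprehension R1 R2 p12); trivial.
      intros B HB. apply Sigma1_comprehension; trivial.
      apply (sat_Pf_flat_preserves_wqo e E). apply HM'. now right.
Qed.
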